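(* Let $T>0$, $t_0\in\mathbb{R}$, $b_1,\dots,b_m\in\mathbb{R}^n$, and let $c_1,\dots,c_m\colon\mathbb{R}\to\mathbb{R}$ be Lipschitz continuous $T$-periodic functions. For $t\in\mathbb{R}$ set $$C(t)=\{z\in\mathbb{R}^n:\ \langle b_i,z\rangle\le c_i(t)\ \text{for every } i=1,\dots,m\},$$ and assume that $C(t)$ is nonempty and compact for every $t\in\mathbb{R}$, and that LPAF (local permanence of the active faces) holds at almost every $t\in\mathbb{R}$. Let $z\colon[t_0,+\infty)\to\mathbb{R}^n$ be a solution of the sweeping process $$\dot z(t)\in-\mathcal{N}_{C(t)}(z(t)).$$ Then there exists a $T$-periodic solution $\bar z$ of $\dot{\bar z}(t)\in-\mathcal{N}_{C(t)}(\bar z(t))$ such that $$\lim_{q\to\infty}\ \| z(\cdot+qT)-\bar z(\cdot)\|_{W^{1,2}([t_0,t_0+T];\mathbb{R}^n)}=0,$$ where $q$ ranges over the positive integers.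
   Context: $\mathcal{N}_{C}(x)=\{v\in\mathbb{R}^n:\langle v,y-x\rangle\le 0\ \forall y\in C\}$ is the normal cone of convex analysis to a closed convex set $C$ at $x\in C$. A solution of $\dot z\in-\mathcal{N}_{C(t)}(z)$ on an interval $I$ is a (locally) absolutely continuous function $z$ on $I$ with $z(t)\in C(t)$ for every $t\in I$, satisfying the inclusion for a.e. $t\in I$. For $z\in C(t)$ the set of active constraints is $J(t,z)=\{i\in\{1,\dots,m\}:\langle b_i,z\rangle=c_i(t)\}$, and $\mathcal{F}(t)=\{J(t,z):z\in C(t)\}$ is the family of index sets active at some point of $C(t)$. LPAF holds at time $t$ if there exists a neighbourhood $\mathcal{U}_t$ of $t$ such that $\mathcal{F}(s)=\mathcal{F}(t)$ for every $s\in\mathcal{U}_t$. *)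

(* Defs.v *)
From mathcomp Require Import all_boot all_order all_algebra.
From mathcomp Require Import all_classical all_reals all_analysis.

Set Implicit Arguments.
Unset Strict Implicit.
Unset Printing Implicit Defensive.

Import Order.TTheory GRing.Theory Num.Theory.
Import numFieldTopology.Exports numFieldNormedType.Exports.

Local Open Scope classical_set_scope.
Local Open Scope ring_scope.

Definition dotv (R : realType) (n : nat) (u v : 'rV[R]_n) : R :=
  \sum_(j < n) u ord0 j * v ord0 j.

(* The library norm `|v| on row vectors is the sup norm, not this one. *)
Definition enorm (R : realType) (n : nat) (v : 'rV[R]_n) : R :=
  Num.sqrt (dotv v v).

Definition normal_cone (R : realType) (n : nat) (C : set 'rV[R]_n)
    (x : 'rV[R]_n) : set 'rV[R]_n :=
  [set v | forall y, C y -> dotv v (y - x) <= 0].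

Definition polyhedron (R : realType) (n m : nat) (b : 'I_m -> 'rV[R]_n)
    (c : 'I_m -> R -> R) (t : R) : set 'rV[R]_n :=
  [set z | forall i, dotv (b i) z <= c i t].

Definition active (R : realType) (n m : nat) (b : 'I_m -> 'rV[R]_n)
    (c : 'I_m -> R -> R) (t : R) (z : 'rV[R]_n) : {set 'I_m} :=
  [set i | dotv (b i) z == c i t]%SET.

Definition active_family (R : realType) (n m : nat) (b : 'I_m -> 'rV[R]_n)
    (c : 'I_m -> R -> R) (t : R) : set {set 'I_m} :=
  [set active b c t z | z in polyhedron b c t].

Definition LPAF (R : realType) (n m : nat) (b : 'I_m -> 'rV[R]_n)
    (c : 'I_m -> R -> R) (t : R) : Prop :=
  \forall s \near t, active_family b c s = active_family b c t.

Definition abs_continuous (R : realType) (n : nat) (a b : R)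
    (f : R -> 'rV[R]_n) : Prop :=
  forall e : R, 0 < e -> exists2 d : R, 0 < d &
    forall (N : nat) (x y : 'I_N -> R),
      (forall k, a <= x k <= y k /\ y k <= b) ->
      trivIset setT (fun k => `]x k, y k[%classic) ->
      \sum_(k < N) (y k - x k) < d ->
      \sum_(k < N) enorm (f (y k) - f (x k)) < e.

Definition locally_abs_continuous (R : realType) (n : nat) (I : interval R)
    (f : R -> 'rV[R]_n) : Prop :=
  forall a b : R, a \in I -> b \in I -> abs_continuous a b f.

(* Functions on I are total functions whose values outside I are irrelevant;
   the two-sided derivative at an endpoint of I does see those values, but
   endpoints form a null set. *)
Definition sweeping_solution (R : realType) (n : nat) (C : R -> set 'rV[R]_n)
    (I : interval R) (z : R -> 'rV[R]_n) : Prop :=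
  [/\ locally_abs_continuous I z,
      forall t, t \in I -> C t (z t)
    & {ae lebesgue_measure, forall t : R, t \in I ->
        derivable z t 1 /\ normal_cone (C t) (z t) (- 'D_1 z t)}].

(* W^{1,2}([a, b]; R^n) is the space of absolutely continuous f with f and f' in
   L^2; the a.e. derivative of such an f represents its weak derivative.
   The value is +oo when f is not in this space. *)
Definition W12_norm (R : realType) (n : nat) (a b : R) (f : R -> 'rV[R]_n) :
    \bar R :=
  (if `[< abs_continuous a b f >] then
     (\int[lebesgue_measure]_(t in `[a, b])
        (enorm (f t) ^+ 2 + enorm ('D_1 f t) ^+ 2)%:E) `^ 2^-1
   else +oo)%E.

(* Main.v *)
From HB Require Import structures.
Require Import Defs.
From mathcomp Require Import all_boot all_order all_algebra.
From mathcomp Require Import all_classical all_reals all_analysis measurable_realfun.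
From mathcomp Require Import ring lra.
Import Order.TTheory GRing.Theory Num.Theory.
Import numFieldTopology.Exports numFieldNormedType.Exports.
Local Open Scope classical_set_scope.
Local Open Scope ring_scope.

Set Implicit Arguments.
Unset Strict Implicit.
Unset Printing Implicit Defensive.

(** The distance between two solutions is nonincreasing, so [z (t + q T)]
    converges, uniformly in [t], along a subsequence realizing a cluster point of
    [z (t0 + q T)].  A uniform limit [y] of solutions is a solution: where LPAF
    holds, a point of [C t] extends to a Lipschitz selection of [C] near [t],
    against which the solutions can be tested.  The distance between [y] and its
    translate [y (t + T)] is constant, hence so is their difference, and this
    difference vanishes since [C] is bounded and periodic.

    For the velocities, fix [t1] where LPAF holds and let [J] be the active set at
    [y t1].  There is a Lipschitz curve [w] with [<b_i, w s> = c_i s] for [i] in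
    [J], and every solution [x] that stays close to [y t1] satisfies
    [<x', x'> = <x', w'>] a.e. near [t1].  Hence
    [|x' - y'|^2 = <x' - y', w' - 2 y'>], and the uniform convergence, which gives
    weak convergence of the velocities, gives strong convergence near [t1].  The
    exceptional times are covered by an open set of small measure, and compactness
    of [[t0, t0 + T]] does the rest. *)

(** The speed of a solution is bounded by the constraints alone: where the two-sided derivative
    exists, each active constraint gives an equation [<b_i, z'> = c_i'], and any solution of this
    linear system bounds [|z'|]. All solutions are therefore Lipschitz with one constant [K], and
    their derivatives have bounded measurable densities.

    The distance between [y] and its translate is constant because the distance between [z] and its
    own translate is nonincreasing, hence has a limit, and every value of the former is that limit.
    Constant distance forces constant difference because [C] is polyhedral: equality in the
    contraction makes both negated velocities normal at the midpoint of the two positions, and a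
    constraint active there is active at both positions and prescribes the same component of both
    velocities.

    Normal vectors are never written as combinations of the active [b_i]; orthogonality to the
    directions that leave the active constraints unchanged is enough. LPAF enters through
    solvability: it provides, at nearby times, points with the same active set, so that the
    equations defining [w] are consistent although the [b_i] may be dependent. *)

(** * Null sets and the mean value inequality for absolutely continuous functions *)

Lemma lebesgue_aeS (R : realType) (P Q : R -> Prop) :
  (forall t, P t -> Q t) ->
  {ae lebesgue_measure, forall t, P t} -> {ae lebesgue_measure, forall t, Q t}.
Proof.
move=> PQ; apply: filterS; first exact: (ae_filter_ringOfSetsType lebesgue_measure).
exact: PQ.
Qed.

Lemma lebesgue_aeI (R : realType) (P Q : R -> Prop) :
  {ae lebesgue_measure, forall t, P t} -> {ae lebesgue_measure, forall t, Q t} ->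
  {ae lebesgue_measure, forall t, P t /\ Q t}.
Proof.
move=> aeP; apply: filterI aeP.
exact: (ae_filter_ringOfSetsType lebesgue_measure).
Qed.

(** The supremum of the points reachable from [a] is itself reached, and is passed unless it is [b].
    This is compactness of an interval in the form suited to additive properties; it serves both the
    mean value inequality and the gluing of the local convergence of velocities. *)
Lemma interval_induction (R : realType) (P : R -> R -> Prop) (a b : R) :
  a <= b ->
  (forall u v w, a <= u -> u <= v -> v <= w -> w <= b ->
    P u v -> P v w -> P u w) ->
  (forall t, a <= t <= b -> exists2 d, 0 < d & forall u v,
    a <= u -> v <= b -> t - d < u -> u <= t -> t <= v -> v < t + d -> P u v) ->
  P a b.
Proof.
move=> ab Padd Ploc.
pose S := [set x | a <= x <= b /\ P a x].
have Sa : S a.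
  split; first by rewrite lexx.
  have [|d d0] := Ploc a; first by rewrite lexx.
  by apply; rewrite ?lexx// ?ltrBlDr ?ltrDl.
have Sub : ubound S b by move=> x [/andP[]].
have hS : has_sup S by split; [exists a | exists b].
have sb : sup S <= b by apply: ge_sup => //; exists a.
have sa : a <= sup S by apply: ub_le_sup => //; exists b.
have [|d d0 Pd] := Ploc (sup S); first by rewrite sa.
have [x [/andP[ax xb] Pax] xs] := sup_adherent d0 hS.
have xsup : x <= sup S.
  by apply: ub_le_sup; [exists b | split=> //; rewrite ax].
have Pn v : sup S <= v -> v <= b -> v < sup S + d -> P a v.
  move=> sv vb vd; apply: (Padd a x v) => //; first exact: le_trans sv.
  exact: Pd.
have [sltb|bs] := ltP (sup S) b; last first.
  by apply: Pn => //; rewrite (le_lt_trans bs)// ltrDl.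
pose v := Num.min b (sup S + d / 2).
have sv : sup S < v by rewrite /v lt_min sltb ltrDl divr_gt0.
have vb : v <= b by rewrite /v ge_min lexx.
have Sv : S v.
  split; first by rewrite vb (le_trans sa) ?ltW.
  apply: Pn => //; first exact: ltW.
  by rewrite /v gt_min ltrD2l [d / 2 < _]gtr_pMr// invf_lt1// ltr1n orbT.
have : v <= sup S by apply: ub_le_sup => //; exists b.
by rewrite leNgt sv.
Qed.

Lemma ae_open_cover (R : realType) (P : R -> Prop) (e : R) :
  {ae lebesgue_measure, forall t, P t} -> 0 < e ->
  exists O : set R, [/\ open O, (forall t, ~ P t -> O t) &
    (lebesgue_measure O < e%:E)%E].
Proof.
move=> [N [mN N0 PN]] e0.
have N0le : (lebesgue_measure N <= 0)%E by rewrite N0.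
have [|U [oU NU Ue]] := @lebesgue_regularity_outer R N e mN _ e0.
  exact: le_lt_trans N0le (ltry _).
exists U; split => //; first by move=> t nP; apply: NU; exact: PN.
(* Outer regularity controls only [U] minus [N]; the rest of [U] is the null set [N]. *)
have mU := open_measurable oU.
rewrite -(setDUK NU); apply: le_lt_trans Ue; rewrite -[leRHS]add0e.
by apply: le_trans (leeD N0le (lexx _)); apply: measureU2 => //; exact: measurableD.
Qed.

Definition scalar_ac (R : realType) (a b : R) (f : R -> R) : Prop :=
  forall e : R, 0 < e -> exists2 d : R, 0 < d &
    forall (N : nat) (x y : 'I_N -> R),
      (forall k, a <= x k <= y k /\ y k <= b) ->
      trivIset setT (fun k => `]x k, y k[%classic) ->
      \sum_(k < N) (y k - x k) < d ->
      \sum_(k < N) `|f (y k) - f (x k)| < e.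

(** Differentiability at [t] bounds the increments over [[u, t]] and [[t, v]] separately, with
    errors proportional to their lengths. As [t] lies between [u] and [v], these lengths add up to
    [v - u]. *)
Lemma straddle (R : realType) (f : R -> R) (t K e : R) :
  derivable f t 1 -> 'D_1 f t <= K -> 0 < e ->
  exists2 d, 0 < d & forall u v, t - d < u -> u <= t -> t <= v -> v < t + d ->
    f v - f u <= (K + e) * (v - u).
Proof.
move=> df dK e0.
have := df; rewrite /derivable => /cvgrPdist_lt/(_ _ e0)[d /= d0 H].
have {}H h : `|h| < d -> `|f (t + h) - f t - h * 'D_1 f t| <= e * `|h|.
  move=> hd; have [->|h0] := eqVneq h 0.
    by rewrite addr0 mul0r subr0 subrr !normr0 mulr0.
  have := H h _ h0; rewrite /= sub0r normrN => /(_ hd).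
  rewrite -/(derive f t 1) => /ltW; rewrite /GRing.scale/= mulr1.
  rewrite [h + t]addrC distrC => Hh.
  have -> : f (t + h) - f t - h * 'D_1 f t
     = h * (h^-1 * (f (t + h) - f t) - 'D_1 f t) by field.
  by rewrite normrM mulrC ler_wpM2r.
exists d => // u v ud ut tv vd.
have /ler_normlP[_ H1] := H (v - t) ltac:(rewrite ger0_norm; lra).
have /ler_normlP[H2 _] := H (u - t) ltac:(rewrite ler0_norm; lra).
move: H1 H2; rewrite (@ger0_norm _ (v - t)) ?subr_ge0//.
rewrite (@ler0_norm _ (u - t)) ?subr_le0// !subrKC.
by nra.
Qed.

(** Good times are handled by [straddle]; the others are covered by an open set of small measure,
    over which absolute continuity makes the total variation of [f] small. *)
Lemma ac_derive_le (R : realType) (f : R -> R) (a b K : R) :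
  a <= b -> scalar_ac a b f ->
  {ae lebesgue_measure, forall t, a < t < b ->
     derivable f t 1 /\ 'D_1 f t <= K} ->
  f b - f a <= K * (b - a).
Proof.
move=> ab acf aef.
apply/ler_addgt0Pl => e e0.
pose e' := e / 2 / (b - a + 1).
have ba1 : 0 < b - a + 1 by rewrite ltr_wpDl ?subr_ge0.
have e'0 : 0 < e' by rewrite !divr_gt0.
have e20 : 0 < e / 2 / 2 by rewrite !divr_gt0.
have [d1 d10 Hd] := acf _ e20.
have K1 : 0 < `|K + e'| + 1 by rewrite ltr_wpDl.
(* The second bound keeps the term with [|K + e'|] below [e / 4]; absolute continuity costs another
   [e / 4], and [e'] the remaining [e / 2]. *)
pose d := Num.min d1 (e / 2 / 2 / (`|K + e'| + 1)).
have d0 : 0 < d by rewrite /d lt_min d10 divr_gt0.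
have aeab : {ae lebesgue_measure, forall t : R, t <> a /\ t <> b}.
  exists ([set a] `|` [set b]); split; [exact: measurableU | | ].
    by rewrite measureU0//; exact: lebesgue_measure_set1.
  by move=> t /= /not_andP[] /contrapT ->; [left|right].
have aeQ : {ae lebesgue_measure, forall t, (t <> a /\ t <> b) /\
    (a < t < b -> derivable f t 1 /\ 'D_1 f t <= K)}.
  exact: lebesgue_aeI aeab aef.
have [ O [oO HO mO]] := ae_open_cover aeQ d0.
(* The linear bound may fail by what happens on finitely many disjoint intervals inside [O]. At a
   bad time one interval []u, v]] suffices, and the term with [|K + e'|] compensates for a possibly
   negative [K + e']. *)
pose P u v := exists N (x y : 'I_N -> R),
  [/\ forall k, u <= x k <= y k /\ y k <= v,
      trivIset setT (fun k => `]x k, y k[%classic),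
      forall k, `]x k, y k[%classic `<=` O &
      f v - f u <= (K + e') * (v - u) + `|K + e'| * \sum_(k < N) (y k - x k)
         + \sum_(k < N) `|f (y k) - f (x k)| ].
have : P a b.
  apply: interval_induction => //.
    move=> u v w au uv vw wb [N [x [y [xy Txy xyO Hf]]]].
    move=> [N' [x' [y' [xy' Txy' xyO' Hf']]]].
    pose X (k : 'I_(N + N')) := match fintype.split k with inl i => x i | inr i => x' i end.
    pose Y (k : 'I_(N + N')) := match fintype.split k with inl i => y i | inr i => y' i end.
    exists (N + N')%N, X, Y; split.
    - move=> k; rewrite /X /Y; case: fintype.split => i.
        by have [H1 H2] := xy i; split=> //; exact: le_trans vw.
      by have [/andP[H1 H2] H3] := xy' i; rewrite H2 (le_trans uv).
    - move=> k k' _ _; rewrite /X /Y.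
      have := splitK k; have := splitK k'.
      case: (fintype.split k') => i' <-; case: (fintype.split k) => i <-;
        move=> -[t [/=]]; rewrite !in_itv/= => t1 t2.
      + by congr lshift; apply: Txy => //; exists t; rewrite /= !in_itv.
      + by exfalso; have := xy i'; have := xy' i; move: t1 t2; lra.
      + by exfalso; have := xy i; have := xy' i'; move: t1 t2; lra.
      + by congr rshift; apply: Txy' => //; exists t; rewrite /= !in_itv.
    - by move=> k; rewrite /X /Y; case: fintype.split.
    - rewrite !big_split_ord/=.
      have Xl k : X (lshift N' k) = x k.
        by rewrite /X -[lshift _ _]/(unsplit (inl k)) unsplitK.
      have Xr k : X (rshift N k) = x' k.
        by rewrite /X -[rshift _ _]/(unsplit (inr k)) unsplitK.
      have Yl k : Y (lshift N' k) = y k.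
        by rewrite /Y -[lshift _ _]/(unsplit (inl k)) unsplitK.
      have Yr k : Y (rshift N k) = y' k.
        by rewrite /Y -[rshift _ _]/(unsplit (inr k)) unsplitK.
      have -> : \sum_(k < N) (Y (lshift N' k) - X (lshift N' k)) =
          \sum_(k < N) (y k - x k) by apply: eq_bigr => k _; rewrite Xl Yl.
      have -> : \sum_(k < N') (Y (rshift N k) - X (rshift N k)) =
          \sum_(k < N') (y' k - x' k) by apply: eq_bigr => k _; rewrite Xr Yr.
      have -> : \sum_(k < N) `|f (Y (lshift N' k)) - f (X (lshift N' k))| =
          \sum_(k < N) `|f (y k) - f (x k)|.
        by apply: eq_bigr => k _; rewrite Xl Yl.
      have -> : \sum_(k < N') `|f (Y (rshift N k)) - f (X (rshift N k))| =
          \sum_(k < N') `|f (y' k) - f (x' k)|.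
        by apply: eq_bigr => k _; rewrite Xr Yr.
      by move: Hf Hf'; lra.
  move=> t /andP[at_ tb].
  have [Qt|/HO Ot] := pselect ((t <> a /\ t <> b) /\
    (a < t < b -> derivable f t 1 /\ 'D_1 f t <= K)).
    have [|dt Dt] := Qt.2.
      by rewrite !lt_neqAle at_ tb !andbT; apply/andP; split;
        apply/eqP; [move/esym|]; case: Qt => -[].
    have [r r0 Hr] := straddle dt Dt e'0.
    exists r => // u v _ _ ur ut tv vr.
    exists 0%N, (fun=> 0), (fun=> 0).
    by split; [case|case|case| rewrite !big_ord0 mulr0 !addr0; exact: Hr].
  have /nbhs_ballP[r /= r0 rO] := open_nbhs_nbhs (conj oO Ot).
  exists r => // u v au vb ur ut tv vr.
  exists 1%N, (fun=> u), (fun=> v); split.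
  - by move=> _; rewrite lexx (le_trans ut).
  - by move=> i j _ _ _; rewrite !ord1.
  - move=> _ s /=; rewrite in_itv/= => s1; apply: rO; rewrite /ball/=.
    by rewrite ltr_norml; lra.
  - rewrite !big_ord_recl !big_ord0 !addr0.
    have := ler_norm (f v - f u); have := ler_norm (- (K + e')); rewrite normrN.
    have : 0 <= v - u by lra.
    nra.
move=> [N [x [y [xy Txy xyO Hf]]]].
have Sd : \sum_(k < N) (y k - x k) < d.
  rewrite -lte_fin; apply: le_lt_trans mO.
  rewrite -sumEFin.
  rewrite (eq_bigr (fun k => lebesgue_measure `]x k, y k[%classic)); last first.
    move=> k _; rewrite lebesgue_measure_itv/= lte_fin.
    case: ltP => // H; have := xy k => -[/andP[_ H'] _].
    by congr EFin; apply/eqP; rewrite subr_eq0; apply/eqP/le_anti; rewrite H H'.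
  rewrite -(@measure_bigsetU_ord)//.
  apply: le_measure; rewrite ?inE.
  - exact: bigsetU_measurable.
  - exact: open_measurable.
  - by apply: (big_ind (fun A => A `<=` O)) => // A B AO BO; rewrite subUset.
have Sd1 : \sum_(k < N) (y k - x k) < d1.
  by apply: lt_le_trans Sd _; rewrite /d ge_min lexx.
have H1 := Hd N x y xy Txy Sd1.
have Sd2 : (`|K + e'| + 1) * \sum_(k < N) (y k - x k) <= e / 2 / 2.
  rewrite mulrC -ler_pdivlMr//; apply: le_trans (ltW Sd) _.
  by rewrite /d ge_min lexx orbT.
have S0 : 0 <= \sum_(k < N) (y k - x k).
  by apply: sumr_ge0 => k _; rewrite subr_ge0; case: (xy k) => /andP[].
have e'ba : e' * (b - a) <= e / 2.
  have <- : e' * (b - a + 1) = e / 2 by rewrite /e' divfK ?gt_eqF.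
  by rewrite ler_wpM2l ?(ltW e'0)// lerDl.
by move: Hf H1 Sd2 S0 e'ba; lra.
Qed.

(** * Lipschitz functions as integrals of bounded densities *)

Lemma klip_cont (R : realType) (f : R -> R) (K : R) :
  (forall x y, `|f x - f y| <= K * `|x - y|) -> continuous f.
Proof.
move=> fK x; apply/cvgrPdist_lt => e e0.
have K0 : 0 < `|K| + 1 by rewrite ltr_wpDl.
near=> y; apply: le_lt_trans (fK x y) _.
have : `|x - y| < e / (`|K| + 1).
  near: y; apply: (@cvgr_dist_lt _ _ _ _ _ idfun); last exact: divr_gt0.
  exact: cvg_id.
rewrite ltr_pdivlMr// mulrC; apply: le_lt_trans.
by rewrite ler_wpM2r// (le_trans (ler_norm _))// lerDl.
Unshelve. all: by end_near. Qed.

Lemma klip_derive_le (R : realType) (f : R -> R) (K d x : R) :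
  0 <= K -> (forall x y, `|f x - f y| <= K * `|x - y|) ->
  is_derive x 1 f d -> `|d| <= K.
Proof.
move=> K0 fK [df <-]; have := df; rewrite /derivable => /cvgrPdist_le H.
apply/ler_addgt0Pl => e e0.
have [r /= r0 Hr] := H _ e0.
have r2 : 0 < r / 2 by rewrite divr_gt0.
have := Hr (r / 2) _ (lt0r_neq0 r2); rewrite /= sub0r normrN gtr0_norm//.
rewrite [r / 2 < _]gtr_pMr// invf_lt1// ltr1n => /(_ isT).
rewrite -/(derive f x 1) distrC => H1.
have H2 : `|(r / 2)^-1 *: (f (r / 2 *: 1 + x) - f x)| <= K.
  rewrite normrZ gtr0_norm ?invr_gt0// ler_pdivrMl//.
  apply: le_trans (fK _ _) _.
  by rewrite addrK /GRing.scale/= mulr1 gtr0_norm// mulrC.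
move: H1 H2; set D := _ *: _ => H1 H2.
have -> : 'D_1 f x = D - (D - 'D_1 f x) by rewrite opprB addrC subrK.
apply: le_trans (ler_normB _ _) _. by rewrite [e + K]addrC lerD.
Qed.

(* The Stieltjes measures of [F] and [G] add up to the Lebesgue measure, which
   makes both of them absolutely continuous. *)
Lemma increasing_density (R : realType) (F G : R -> R) (A B : R) :
  nondecreasing_fun F -> nondecreasing_fun G ->
  continuous F -> continuous G -> (forall x, F x + G x = x) ->
  exists k : R -> R,
    lebesgue_measure.-integrable setT (EFin \o k) /\
    forall u v, A <= u -> u <= v -> v <= B ->
      (\int[lebesgue_measure]_(x in `]u, v]) (k x)%:E = (F v - F u)%:E)%E.
Proof.
move=> Fnd Gnd Fc Gc FG.
have Frc : right_continuous F by move=> x; apply: cvg_at_right_filter; exact: Fc.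
have Grc : right_continuous G by move=> x; apply: cvg_at_right_filter; exact: Gc.
pose F' : cumulative R R := HB.pack F (isCumulative.Build R _ R F Fnd Frc).
pose G' : cumulative R R := HB.pack G (isCumulative.Build R _ R G Gnd Grc).
pose nuF := lebesgue_stieltjes_measure F'.
pose nuG := lebesgue_stieltjes_measure G'.
have nuFoc u v : u <= v -> nuF `]u, v]%classic = (F v - F u)%:E.
  move=> uv; rewrite /nuF /lebesgue_stieltjes_measure.
  by rewrite /measure_extension measurable_mu_extE/= ?wlength_itv_bnd//; exact: is_ocitv.
have nuGoc u v : u <= v -> nuG `]u, v]%classic = (G v - G u)%:E.
  move=> uv; rewrite /nuG /lebesgue_stieltjes_measure.
  by rewrite /measure_extension measurable_mu_extE/= ?wlength_itv_bnd//; exact: is_ocitv.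
have nuFG (X : set (measurableTypeR R)) : measurable X ->
    lebesgue_measure X = measure_add nuF nuG X.
  apply: (@lebesgue_measure_unique R (measure_add nuF nuG)) => {}X [[u v] /=] _ <-.
  apply: etrans (esym (measure_addE _ _ _)); have [uv|vu] := leP u v.
    transitivity (v - u)%:E.
      rewrite lebesgue_measure_itv/= lte_fin.
      by case: ltgtP uv => // ->; rewrite subrr.
    apply: esym; transitivity ((F v - F u)%:E + (G v - G u)%:E)%E.
      by congr (_ + _)%E; [exact: nuFoc | exact: nuGoc].
    by rewrite -EFinD; congr EFin; have := FG u; have := FG v; lra.
  rewrite set_itv_ge ?bnd_simp -?leNgt ?ltW//.
  apply: etrans (measure0 _) _; rewrite -[LHS]adde0.
  by congr (_ + _)%E; apply: esym; exact: measure0.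
have mAB : measurable (`]A, B]%classic : set (measurableTypeR R)).
  exact: measurable_itv.
have nuoo : (nuF `]A, B]%classic < +oo)%E.
  have [AB|BA] := leP A B; first by rewrite nuFoc// ltry.
  rewrite set_itv_ge ?bnd_simp -?leNgt ?ltW//.
  have nu0 : (nuF set0 <= 0)%E by rewrite /nuF measure0.
  exact: le_lt_trans nu0 (ltry _).
(* The Radon-Nikodym theorem is applied to a finite measure, which is why a window []A, B]] is
   fixed. *)
pose nu := mfrestr mAB nuoo.
have nulam : nu `<< (@lebesgue_measure R).
  apply/null_content_dominatesP => X mX X0.
  have nuX0 : (nuF X + nuG X = 0)%E.
    by apply: etrans (esym (measure_addE _ _ _)) _; rewrite -nuFG.
  apply/eqP; rewrite eq_le measure_ge0 andbT.
  apply: (@le_trans _ _ (nuF X)).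
    by apply: le_measure; rewrite ?inE//; exact: measurableI.
  by rewrite -nuX0 leeDl// measure_ge0.
have [h [h0 hfin hint hnu]] := radon_nikodym_sigma_finite nulam.
exists (fine \o h).
have hE : (EFin \o (fine \o h)) = h by apply/funext => x /=; rewrite fineK.
split; first by rewrite hE.
move=> u v Au uv vB.
rewrite -[X in (\int[_]_(x in _) X x)%E]/(EFin \o (fine \o h)) hE -hnu//.
rewrite -nuFoc// /nu /mfrestr /mrestr; congr (nuF _).
apply/seteqP; split=> x /=; rewrite !in_itv/=; first by case.
by move=> /andP[ux xv]; split; rewrite ?ux// (le_lt_trans Au)//= (le_trans xv).
Qed.

Lemma lebesgue_ae_neq (R : realType) (a : R) :
  {ae lebesgue_measure, forall t : R, t <> a}.
Proof.
exists [set a]; split; [exact: measurable_set1 | exact: lebesgue_measure_set1 | ].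
by move=> t /= /contrapT.
Qed.

Lemma ae_eq_Rintegral (R : realType) (D : set R) (f g : R -> R) :
  measurable D -> measurable_fun D f -> measurable_fun D g ->
  {ae lebesgue_measure, forall t, D t -> f t = g t} ->
  \int[lebesgue_measure]_(t in D) f t = \int[lebesgue_measure]_(t in D) g t.
Proof.
move=> mD mf mg aefg; congr fine; apply: ae_eq_integral => //;
  try exact/measurable_EFinP.
by apply: lebesgue_aeS aefg => t H Dt /=; rewrite H.
Qed.

Lemma bounded_itv_integrable (R : realType) (f : R -> R) (M u v : R) :
  measurable_fun setT f -> (forall x, `|f x| <= M) ->
  lebesgue_measure.-integrable `[u, v] (EFin \o f).
Proof.
move=> mf fM.
have uvoo : (lebesgue_measure (`[u, v]%classic : set R) < +oo)%E.
  by rewrite lebesgue_measure_itv/=; case: ifPn => // _; rewrite -EFinB ltry.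
apply: (measurable_bounded_integrable _ uvoo) => //.
- exact: measurable_funTS.
- exists M; split; first exact: num_real.
  by move=> N MN x _ /=; exact: le_trans (ltW MN).
Qed.

Lemma fine_lebesgue_itv (R : realType) (u v : R) : u <= v ->
  fine (lebesgue_measure `[u, v]%classic) = v - u.
Proof.
rewrite lebesgue_measure_itv/= lte_fin.
by case: ltgtP => // ->; rewrite subrr.
Qed.

(** With [F = (x + f / K) / 2] and [G = (x - f / K) / 2], the Lipschitz bound says that both are
    nondecreasing, and they add up to the identity. So [increasing_density] gives a density of [F],
    and [f = K * (2 * F - x)] transfers it to [f]; differentiability a.e. comes from Lebesgue
    differentiation of the integral. *)
Lemma lip_density (R : realType) (f : R -> R) (K A B : R) :
  0 < K -> (forall x y, `|f x - f y| <= K * `|x - y|) ->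
  exists g : R -> R, [/\ measurable_fun setT g,
    forall x, `|g x| <= K,
    {ae lebesgue_measure, forall x, A < x < B -> is_derive x 1 f (g x)} &
    forall u v, A <= u -> u <= v -> v <= B ->
      \int[lebesgue_measure]_(x in `[u, v]) g x = f v - f u].
Proof.
move=> K0 fK.
have fc : continuous f by exact: klip_cont fK.
have fKle x y : x <= y -> - (K * (y - x)) <= f y - f x <= K * (y - x).
  move=> xy; have := fK y x; rewrite [`|y - x|]ger0_norm ?subr_ge0//.
  by rewrite ler_norml.
pose F x := (x + K^-1 * f x) / 2.
pose G x := (x - K^-1 * f x) / 2.
have fK' x y : x <= y -> - (y - x) <= K^-1 * f y - K^-1 * f x <= y - x.
  move=> xy; rewrite -mulrBr ler_pdivrMl// ler_pdivlMl// mulrN.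
  exact: fKle.
have Fnd : nondecreasing_fun F.
  by move=> x y /fK'; rewrite /F => /andP[? ?]; lra.
have Gnd : nondecreasing_fun G.
  by move=> x y /fK'; rewrite /G => /andP[? ?]; lra.
have Fc : continuous F.
  move=> x; apply: cvgM; last exact: cvg_cst.
  by apply: cvgD; [exact: cvg_id | apply: cvgM; [exact: cvg_cst | exact: fc]].
have Gc : continuous G.
  move=> x; apply: cvgM; last exact: cvg_cst.
  by apply: cvgB; [exact: cvg_id | apply: cvgM; [exact: cvg_cst | exact: fc]].
have FG x : F x + G x = x by rewrite /F /G; lra.
have [k [kint kF]] := increasing_density A B Fnd Gnd Fc Gc FG.
have fE x : f x = K * (2 * F x - x) by rewrite /F; field; rewrite gt_eqF.
pose g0 x := K * (2 * k x - 1).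
have kloc : locally_integrable setT k by exact: (open_integrable_locally openT kint).
have kint' (a : itv_bound R) y :
    lebesgue_measure.-integrable [set` Interval a (BRight y)] (EFin \o k).
  exact: integrableS kint.
have aed : {ae lebesgue_measure, forall x, A < x < B -> is_derive x 1 f (g0 x)}.
  apply: lebesgue_aeS (FTC1 (kint' (BRight A)) kloc) => x H /andP[Ax xB].
  have {H}[H1 H2] := H Ax.
  pose F0 y := \int[lebesgue_measure]_(t in [set` Interval (BRight A) (BRight y)]) k t.
  have dF0 : is_derive x 1 F0 (k x) by apply: DeriveDef H1 _; rewrite -derive1E.
  pose f1 y := K * (2 * (F A + F0 y) - y).
  have d1 : is_derive x 1 f1 (g0 x).
    have := is_deriveZ K (is_deriveB (is_deriveZ 2 (is_deriveD
      (is_derive_cst (F A) x 1) dF0)) (is_derive_id x 1)).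
    by rewrite add0r.
  apply: near_eq_is_derive d1.
  have xAB : x \in `]A, B[ by rewrite in_itv/= Ax.
  have := near_in_itvoo xAB; apply: filterS => y; rewrite in_itv/= => /andP[Ay yB].
  rewrite fE /f1; congr (_ * (_ * _ - _)).
  by rewrite /F0 /Rintegral kF ?lexx ?(ltW Ay) ?(ltW yB)//= addrC subrK.
(* Inside the window, clamping changes [g0] only on a null set, since a derivative of [f] is at most
   [K] in size. It makes the bound hold at every point of the line. *)
pose g x := Num.max (- K) (Num.min K (g0 x)).
have km : measurable_fun setT k by case/integrableP: kint => /measurable_EFinP.
have g0m : measurable_fun setT g0.
  apply: measurable_funM => //; apply: measurable_funB => //.
  exact: measurable_funM.
have gm : measurable_fun setT g.
  by apply: measurable_maxr => //; apply: measurable_minr.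
exists g; split => //.
- by move=> x; rewrite ler_norml /g le_max lexx/= ge_max ge_min lexx; lra.
- apply: lebesgue_aeS aed => x H xAB; have dx := H xAB.
  suff -> : g x = g0 x by [].
  have := klip_derive_le (ltW K0) fK dx; rewrite ler_norml /g => /andP[H1 H2].
  by rewrite min_r// max_r.
- move=> u v Au uv vB.
  rewrite (@ae_eq_Rintegral _ _ g g0)//; [|exact: measurable_funTS..|].
    have kE : \int[lebesgue_measure]_(x in `[u, v]) k x = F v - F u.
      by rewrite -Rintegral_itv_obnd_cbnd ?kint'// /Rintegral kF.
    have k2 : lebesgue_measure.-integrable `[u, v] (EFin \o (fun x => 2 * k x)).
      rewrite (_ : _ \o _ = fun x => (2%:E * (EFin \o k) x)%E); last first.
        by apply/funext => x /=; rewrite EFinM.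
      by apply: integrableZl => //; exact: kint'.
    have c1 : lebesgue_measure.-integrable `[u, v] (EFin \o (cst 1 : R -> R)).
      by apply: (@bounded_itv_integrable _ _ 1) => // x; rewrite normr1.
    rewrite /g0 RintegralZl//; last first.
      rewrite (_ : _ \o _ = fun x => ((EFin \o (fun x => (2 * k x)%R)) x - (EFin \o (cst 1%R : R -> R)) x)%E).
        by apply: integrableB.
      by apply/funext => x /=; rewrite EFinB.
    rewrite RintegralB//.
    have -> : \int[lebesgue_measure]_(x in `[u, v]) (2 * k x) = 2 * (F v - F u).
      by rewrite -kE; apply: RintegralZl => //; exact: kint'.
    rewrite Rintegral_cst// fine_lebesgue_itv// fE [f u]fE; ring.
  apply: lebesgue_aeS (lebesgue_aeI aed (lebesgue_aeI (@lebesgue_ae_neq _ A) (@lebesgue_ae_neq _ B))).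
  move=> x [H [xA xB]]; rewrite /= in_itv/= => /andP[ux xv].
  have /H dx : A < x < B.
    rewrite !lt_neqAle (le_trans Au)// (le_trans xv)// !andbT.
    by apply/andP; split; apply/eqP; [move/esym|].
  have := klip_derive_le (ltW K0) fK dx; rewrite ler_norml /g => /andP[H1 H2].
  by rewrite min_r// max_r.
Qed.

(** The pushforward of Lebesgue measure by a translation agrees with it on half-open intervals,
    hence everywhere by uniqueness. *)
Lemma lebesgue_ae_shift (R : realType) (P : R -> Prop) (a : R) :
  {ae lebesgue_measure, forall t, P t} ->
  {ae lebesgue_measure, forall t, P (t + a)}.
Proof.
pose sh : measurableTypeR R -> measurableTypeR R := fun t => t + a.
have msh : measurable_fun setT sh by exact: measurable_funD.
pose shm : {mfun measurableTypeR R >-> measurableTypeR R} :=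
  HB.pack sh (isMeasurableFun.Build _ _ _ _ sh msh).
have E (X : set (measurableTypeR R)) : measurable X ->
    lebesgue_measure X = lebesgue_measure (sh @^-1` X).
  apply: (@lebesgue_measure_unique R (pushforward lebesgue_measure shm)).
  move=> {}X [[u v] /=] _ <-; rewrite /pushforward.
  have -> : sh @^-1` `]u, v]%classic = `]u - a, v - a]%classic.
    by apply/seteqP; split=> x /=; rewrite !in_itv/= ltrBlDr lerBrDr.
  by rewrite !lebesgue_measure_itv/= !lte_fin ltrD2r; case: ifP => // _; rewrite -!EFinB; congr EFin; ring.
move=> [N [mN N0 PN]]; exists (sh @^-1` N); split.
- by rewrite -[X in measurable X]setTI; exact: (msh measurableT N mN).
- by rewrite -E.
- by move=> t /= Pt; exact: PN.
Qed.

Lemma klip_measurable (R : realType) (f : R -> R) (K : R) :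
  (forall x y, `|f x - f y| <= K * `|x - y|) -> measurable_fun setT f.
Proof. by move=> fK; apply: continuous_measurable_fun; exact: klip_cont fK. Qed.

Lemma le_Rintegral_bounded (R : realType) (f : R -> R) (M u v : R) : u <= v ->
  measurable_fun setT f -> (forall x, u <= x <= v -> `|f x| <= M) ->
  `|\int[lebesgue_measure]_(x in `[u, v]) f x| <= M * (v - u).
Proof.
move=> uv mf fM.
have fi : lebesgue_measure.-integrable `[u, v] (EFin \o f).
  have uvoo : (lebesgue_measure (`[u, v]%classic : set R) < +oo)%E.
    by rewrite lebesgue_measure_itv/=; case: ifPn => // _; rewrite -EFinB ltry.
  apply: (measurable_bounded_integrable _ uvoo) => //.
    exact: measurable_funTS.
  exists M; split; first exact: num_real.
  move=> N MN x /=; rewrite in_itv/= => xuv; exact: le_trans (fM _ xuv) (ltW MN).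
apply: le_trans (le_normr_Rintegral _ fi) _ => //.
rewrite -(fine_lebesgue_itv uv) -Rintegral_cst//.
apply: le_Rintegral => //.
- by have := integrable_norm fi.
- by apply: (@bounded_itv_integrable _ _ `|M|) => //.
Qed.

(** * Uniform convergence implies weak convergence of derivatives *)

(** Integration by parts: the boundary terms cost [2 * e * L], and the integral of [f] against the
    derivative of [D] costs [e * M * (v - u)]. The bound does not involve the size [K] of [g], so it
    is small when [f] is uniformly small. *)
Lemma lip_mul_Rintegral (R : realType) (f g D : R -> R) (K L M e u v : R) :
  0 < K -> 0 < M -> 0 <= e -> 0 <= L -> u <= v ->
  (forall x y, `|f x - f y| <= K * `|x - y|) -> (forall x, `|f x| <= e) ->
  measurable_fun setT g -> (forall x, `|g x| <= K) ->
  {ae lebesgue_measure, forall x, u < x < v -> is_derive x 1 f (g x)} ->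
  (forall x y, `|D x - D y| <= M * `|x - y|) -> (forall x, `|D x| <= L) ->
  `|\int[lebesgue_measure]_(x in `[u, v]) (g x * D x)| <=
    e * (2 * L + M * (v - u)).
Proof.
move=> K0 M0 e0 L0 uv fK fe mg gK aeg DM DL.
have [d [md dM aed _]] := lip_density u v M0 DM.
pose H x := f x * D x; pose Q := K * L + e * M + 1.
have Q0 : 0 < Q by rewrite /Q ltr_wpDl// addr_ge0// mulr_ge0// ltW.
have HQ x y : `|H x - H y| <= Q * `|x - y|.
  have -> : H x - H y = (f x - f y) * D x + f y * (D x - D y) by rewrite /H; ring.
  apply: le_trans (ler_normD _ _) _; rewrite !normrM.
  have A1 : `|f x - f y| * `|D x| <= K * `|x - y| * L by apply: ler_pM.
  have A2 : `|f y| * `|D x - D y| <= e * (M * `|x - y|) by apply: ler_pM.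
  have := normr_ge0 (x - y); rewrite /Q; nra.
have [h [mh hQ aeh hH]] := lip_density u v Q0 HQ.
have mf := klip_measurable fK; have mD := klip_measurable DM.
have : \int[lebesgue_measure]_(x in `[u, v]) (g x * D x) =
    H v - H u - \int[lebesgue_measure]_(x in `[u, v]) (f x * d x).
  rewrite -hH// -RintegralB//; last 2 first.
  - exact: bounded_itv_integrable mh hQ.
  - apply: (@bounded_itv_integrable _ _ (e * M)); first exact: measurable_funM.
    by move=> x; rewrite normrM ler_pM.
  apply: ae_eq_Rintegral => //.
  - by apply: measurable_funTS; exact: measurable_funM.
  - by apply: measurable_funTS; apply: measurable_funB => //; exact: measurable_funM.
  apply: lebesgue_aeS (lebesgue_aeI (lebesgue_aeI aeg (lebesgue_aeI aed aeh))
    (lebesgue_aeI (@lebesgue_ae_neq _ u) (@lebesgue_ae_neq _ v))).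
  move=> x [[Hg [Hd Hh]] [xu xv]]; rewrite /= in_itv/= => /andP[ux xv'].
  have xuv : u < x < v.
    by rewrite !lt_neqAle ux xv' !andbT; apply/andP; split; apply/eqP; [move/esym|].
  have Hg' := Hg xuv; have Hd' := Hd xuv; have Hh' := Hh xuv.
  have E1 := @derive_val _ _ _ _ _ _ _ (is_deriveM Hg' Hd').
  have E2 := @derive_val _ _ _ _ _ _ _ Hh'.
  rewrite -E2 [X in 'D_1 X x](_ : H = f * D)// E1 /GRing.scale/=; ring.
move=> ->.
have I1 : `|\int[lebesgue_measure]_(x in `[u, v]) (f x * d x)| <= e * M * (v - u).
  apply: le_Rintegral_bounded => //; first exact: measurable_funM.
  by move=> x _; rewrite normrM ler_pM.
have H1 x : `|H x| <= e * L by rewrite normrM ler_pM.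
have := ler_normB (H v - H u) (\int[lebesgue_measure]_(x in `[u, v]) (f x * d x)).
have := ler_normB (H v) (H u); have := H1 u; have := H1 v; move: I1; nra.
Qed.

Lemma difference_quotient_cvg (R : realType) (P : R -> R) (p x : R) :
  is_derive x 1 P p ->
  n.+1%:R * (P (x + n.+1%:R^-1) - P x) @[n --> \oo] --> p.
Proof.
move=> [dP <-]; have := dP; rewrite /derivable => /cvgrPdist_le H.
apply/cvgrPdist_le => e e0.
have [r /= r0 Hr] := H _ e0.
near=> n.
have n0 : (n.+1%:R^-1 : R) != 0 by rewrite invr_eq0 pnatr_eq0.
have := Hr n.+1%:R^-1 _ n0; rewrite /= sub0r normrN ger0_norm ?invr_ge0//.
rewrite invrK /GRing.scale/= mulr1 [x + _]addrC; apply.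
by near: n; exact: near_infty_natSinv_lt (PosNum r0).
Unshelve. all: by end_near. Qed.

(** Integration by parts needs a Lipschitz weight, but [p] is only bounded and measurable. It is
    replaced by the difference quotients [D n] of [P]: these are Lipschitz, are bounded by [L]
    uniformly in [n], and converge to [p] in [L^1] by dominated convergence. *)
Lemma weak_cvg (R : realType) (f g : nat -> R -> R) (P p : R -> R)
    (K L u v : R) : 0 < K -> 0 < L -> u <= v ->
  (forall q x y, `|f q x - f q y| <= K * `|x - y|) ->
  (forall e, 0 < e -> \forall q \near \oo, forall x, `|f q x| <= e) ->
  (forall q, measurable_fun setT (g q)) -> (forall q x, `|g q x| <= K) ->
  (forall q, {ae lebesgue_measure,
    forall x, u < x < v -> is_derive x 1 (f q) (g q x)}) ->
  (forall x y, `|P x - P y| <= L * `|x - y|) ->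
  measurable_fun setT p -> (forall x, `|p x| <= L) ->
  {ae lebesgue_measure, forall x, u < x < v -> is_derive x 1 P (p x)} ->
  \int[lebesgue_measure]_(x in `[u, v]) (g q x * p x) @[q --> \oo] --> 0.
Proof.
move=> K0 L0 uv fK f0 mg gK aeg PL mp pL aep.
pose D n x : R := n.+1%:R * (P (x + n.+1%:R^-1) - P x).
have DL n x : `|D n x| <= L.
  rewrite /D normrM ger0_norm// mulrC -ler_pdivlMr//.
  by apply: le_trans (PL _ _) _; rewrite addrAC subrr add0r ger0_norm// invr_ge0.
have DM n x y : `|D n x - D n y| <= (n.+1%:R * (2 * L)) * `|x - y|.
  rewrite /D -mulrBr normrM ger0_norm// -mulrA ler_wpM2l//.
  have -> : P (x + n.+1%:R^-1) - P x - (P (y + n.+1%:R^-1) - P y) =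
    (P (x + n.+1%:R^-1) - P (y + n.+1%:R^-1)) - (P x - P y) by ring.
  apply: le_trans (ler_normB _ _) _; rewrite mulrAC mulr_natl mulr2n.
  have := PL (x + n.+1%:R^-1) (y + n.+1%:R^-1); have := PL x y.
  have -> : x + n.+1%:R^-1 - (y + n.+1%:R^-1) = x - y by ring.
  lra.
have mD n : measurable_fun setT (D n) by exact: klip_measurable (DM n).
have Dp : (\int[lebesgue_measure]_(x in `[u, v]) (`|D n x - p x|)%:E @[n --> \oo] --> 0)%E.
  have [] := @dominated_convergence _ _ _ lebesgue_measure `[u, v]%classic
    (measurable_itv _) (fun n => EFin \o D n) (EFin \o p) (EFin \o cst L).
  - by move=> n; apply/measurable_EFinP; exact: measurable_funTS (mD n).
  - by apply/measurable_EFinP; exact: measurable_funTS mp.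
  - apply: lebesgue_aeS (lebesgue_aeI aep
      (lebesgue_aeI (@lebesgue_ae_neq _ u) (@lebesgue_ae_neq _ v))).
    move=> x [Hx [xu xv]]; rewrite /= in_itv/= => /andP[ux xv'].
    have xuv : u < x < v.
      by rewrite !lt_neqAle ux xv' !andbT; apply/andP; split; apply/eqP; [move/esym|].
    apply: cvg_EFin; first exact: nearW.
    exact: difference_quotient_cvg (Hx xuv).
  - apply: (@bounded_itv_integrable _ _ L) => // x.
    by rewrite /= ger0_norm// ltW.
  - by apply: aeW => x n _ /=; rewrite lee_fin.
  by move=> _ + _; apply: cvg_trans; apply: near_eq_cvg; apply: nearW => n.
apply/cvgrPdist_le => e e0.
have e1 : 0 < e / 2 / K by rewrite !divr_gt0.
have [n Hn] : exists n, \int[lebesgue_measure]_(x in `[u, v]) `|D n x - p x| <= e / 2 / K.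
  have Dp' : fine (\int[lebesgue_measure]_(x in `[u, v]) `|D n x - p x|%:E)%E
    @[n --> \oo] --> 0 by exact: (fine_cvg Dp).
  have /cvgrPdist_le/(_ _ e1)[n _ /(_ n (leqnn _)) Hn] := Dp'.
  exists n; apply: le_trans Hn; rewrite /= sub0r normrN.
  exact: ler_norm.
(* With [n] now fixed, [C] is the factor given by [lip_mul_Rintegral] for the weight [D n]; it may
   be huge, since [q] is chosen afterwards. *)
pose C := 2 * L + (n.+1%:R * (2 * L)) * (v - u).
have C0 : 0 < C by rewrite /C ltr_wpDr ?mulr_gt0// !mulr_ge0 ?subr_ge0 ?(ltW L0).
have e2 : 0 < e / 2 / C by rewrite !divr_gt0.
apply: filterS (f0 _ e2) => q fe; rewrite sub0r normrN.
have M0 : 0 < n.+1%:R * (2 * L) by rewrite !mulr_gt0.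
have B1 := lip_mul_Rintegral K0 M0 (ltW e2) (ltW L0) uv (fK q) fe (mg q) (gK q)
  (aeg q) (DM n) (DL n).
have mgD : measurable_fun setT (fun x => g q x * (p x - D n x)).
  by apply: measurable_funM => //; exact: measurable_funB.
have mgD' : measurable_fun setT (fun x => g q x * D n x) by exact: measurable_funM.
have Dp2 x : `|D n x - p x| <= L + L.
  by apply: le_trans (ler_normB _ _) _; rewrite lerD.
have gDi : lebesgue_measure.-integrable `[u, v] (EFin \o (fun x => g q x * (p x - D n x))).
  apply: (bounded_itv_integrable (M := K * (L + L))) => // x.
  by rewrite normrM distrC ler_pM.
have gDi' : lebesgue_measure.-integrable `[u, v] (EFin \o (fun x => g q x * D n x)).
  by apply: (bounded_itv_integrable (M := K * L)) => // x; rewrite normrM ler_pM.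
have -> : \int[lebesgue_measure]_(x in `[u, v]) (g q x * p x) =
    \int[lebesgue_measure]_(x in `[u, v]) (g q x * (p x - D n x)) +
    \int[lebesgue_measure]_(x in `[u, v]) (g q x * D n x).
  rewrite -RintegralD//; apply: eq_Rintegral => x _; ring.
apply: le_trans (ler_normD _ _) _; rewrite [leRHS](splitr e) lerD//; last first.
  by apply: le_trans B1 _; rewrite divfK ?gt_eqF.
apply: le_trans (le_normr_Rintegral _ gDi) _ => //.
have Di : lebesgue_measure.-integrable `[u, v] (EFin \o (fun x => `|D n x - p x|)).
  apply: (bounded_itv_integrable (M := L + L)).
    by apply: measurableT_comp => //; exact: measurable_funB.
  by move=> x; rewrite normr_id.
apply: (@le_trans _ _ (\int[lebesgue_measure]_(x in `[u, v]) (K * `|D n x - p x|))).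
  apply: le_Rintegral => //.
  - by have := integrable_norm gDi.
  - apply: (bounded_itv_integrable (M := K * (L + L))).
      by apply: measurable_funM => //; apply: measurableT_comp => //; exact: measurable_funB.
    by move=> x; rewrite normrM normr_id gtr0_norm// ler_wpM2l// ltW.
  - by move=> x _; rewrite normrM distrC ler_wpM2r.
by rewrite RintegralZl// mulrC -ler_pdivlMr.
Qed.

Section nonmeasurable_integrand.
Import HBNNSimple.

(* The integrand [f] need not be measurable: its integral is then a supremum
   over the simple functions below it. *)
Lemma ae_le_integral_nonmeasurable (R : realType) (D : set R) (f g : R -> \bar R) :
  measurable D -> measurable_fun D g ->
  (forall x, D x -> 0 <= f x)%E -> (forall x, D x -> 0 <= g x)%E ->
  {ae lebesgue_measure, forall x, D x -> (f x <= g x)%E} ->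
  (\int[lebesgue_measure]_(x in D) f x <= \int[lebesgue_measure]_(x in D) g x)%E.
Proof.
move=> mD mg f0 g0 aefg.
rewrite [leLHS]integral_mkcond [leRHS]integral_mkcond [leLHS]ge0_integralTE; last first.
  by move=> x; rewrite patchE; case: ifPn => // /[1!inE]; exact: f0.
apply: ge_ereal_sup => _ [h /= hf <-]; rewrite -integralT_nnsfun.
apply: ae_ge0_le_integral => //.
- by move=> x _; rewrite lee_fin; exact: fun_ge0.
- by apply/measurable_EFinP; exact: measurable_funPT.
- by move=> x _; rewrite patchE; case: ifPn => // /[1!inE]; exact: g0.
- exact: (measurable_restrictT g mD).1 mg.
- apply: lebesgue_aeS aefg => x H _; apply: le_trans (hf x) _.
  by rewrite !patchE; case: ifPn => // /[1!inE].
Qed.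

End nonmeasurable_integrand.

(** * Euclidean geometry and derivatives of curves *)

Section dotv_theory.
Variables (R : realType) (n : nat).
Implicit Types u v w : 'rV[R]_n.

Lemma dotvC u v : dotv u v = dotv v u.
Proof. by apply: eq_bigr => j _; rewrite mulrC. Qed.

Lemma dotvDl u v w : dotv (u + v) w = dotv u w + dotv v w.
Proof. by rewrite /dotv -big_split; apply: eq_bigr => j _; rewrite mxE mulrDl. Qed.

Lemma dotvDr u v w : dotv w (u + v) = dotv w u + dotv w v.
Proof. by rewrite dotvC dotvDl !(dotvC w). Qed.

Lemma dotvZl a u v : dotv (a *: u) v = a * dotv u v.
Proof. by rewrite /dotv mulr_sumr; apply: eq_bigr => j _; rewrite mxE mulrA. Qed.

Lemma dotvZr a u v : dotv u (a *: v) = a * dotv u v.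
Proof. by rewrite dotvC dotvZl dotvC. Qed.

Lemma dotvNl u v : dotv (- u) v = - dotv u v.
Proof. by rewrite -scaleN1r dotvZl mulN1r. Qed.

Lemma dotvNr u v : dotv u (- v) = - dotv u v.
Proof. by rewrite dotvC dotvNl dotvC. Qed.

Lemma dotvBl u v w : dotv (u - v) w = dotv u w - dotv v w.
Proof. by rewrite dotvDl dotvNl. Qed.

Lemma dotvBr u v w : dotv w (u - v) = dotv w u - dotv w v.
Proof. by rewrite dotvDr dotvNr. Qed.

Lemma dotv0l u : dotv 0 u = 0.
Proof. by rewrite -(scale0r 0) dotvZl mul0r. Qed.

Lemma dotv0r u : dotv u 0 = 0.
Proof. by rewrite dotvC dotv0l. Qed.

Lemma dotv_ge0 u : 0 <= dotv u u.
Proof. by apply: sumr_ge0 => j _; rewrite -expr2 sqr_ge0. Qed.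

Lemma dotv_eq0 u : dotv u u = 0 -> u = 0.
Proof.
move=> /eqP; rewrite psumr_eq0; last by move=> j _; rewrite -expr2 sqr_ge0.
move=> /allP H; apply/rowP => j; have := H j (mem_index_enum _).
by rewrite /= -expr2 sqrf_eq0 mxE => /eqP.
Qed.

Lemma enorm_ge0 u : 0 <= enorm u.
Proof. exact: sqrtr_ge0. Qed.

Lemma enorm_sqr u : enorm u ^+ 2 = dotv u u.
Proof. exact: sqr_sqrtr (dotv_ge0 u). Qed.

Lemma enorm0 : enorm (0 : 'rV[R]_n) = 0.
Proof. by rewrite /enorm dotv0l sqrtr0. Qed.

Lemma enorm0_eq0 u : enorm u = 0 -> u = 0.
Proof. by move=> u0; apply: dotv_eq0; rewrite -enorm_sqr u0 expr0n. Qed.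

Lemma enormN u : enorm (- u) = enorm u.
Proof. by rewrite /enorm dotvNl dotvNr opprK. Qed.

Lemma enorm_distC u v : enorm (u - v) = enorm (v - u).
Proof. by rewrite -enormN opprB. Qed.

Lemma enormZ a u : enorm (a *: u) = `|a| * enorm u.
Proof.
rewrite /enorm dotvZl dotvZr mulrA -expr2 sqrtrM ?sqr_ge0//.
by rewrite sqrtr_sqr.
Qed.

Lemma dotv_CS u v : `|dotv u v| <= enorm u * enorm v.
Proof.
rewrite -ler_sqr ?nnegrE ?mulr_ge0 ?enorm_ge0 // exprMn !enorm_sqr real_normK ?num_real //.
have [v0|v0] := eqVneq v 0; first by rewrite v0 !dotv0r expr0n mulr0.
have vpos : 0 < dotv v v.
  by rewrite lt_neqAle dotv_ge0 andbT eq_sym; apply: contraNneq v0 => /dotv_eq0 ->.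
have := dotv_ge0 (dotv v v *: u - dotv u v *: v).
rewrite dotvBl !dotvBr !dotvZl !dotvZr (dotvC v u) => H.
rewrite -(ler_pM2l vpos); nra.
Qed.

Lemma enormD u v : enorm (u + v) <= enorm u + enorm v.
Proof.
rewrite -ler_sqr ?nnegrE ?addr_ge0 ?enorm_ge0// enorm_sqr dotvDl !dotvDr (dotvC v u).
rewrite sqrrD !enorm_sqr; have := ler_normlW (dotv_CS u v); lra.
Qed.

Lemma enormB u v : enorm (u - v) <= enorm u + enorm v.
Proof. by rewrite (le_trans (enormD _ _))// enormN. Qed.

Lemma enorm_sub_add w u v : enorm (u - v) <= enorm (u - w) + enorm (w - v).
Proof. by rewrite (le_trans _ (enormD _ _))// addrA subrK. Qed.

Lemma coord_le_enorm u j : `|u ord0 j| <= enorm u.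
Proof.
rewrite -ler_sqr ?nnegrE ?enorm_ge0// real_normK ?num_real // enorm_sqr /dotv (bigD1 j)//=.
by rewrite expr2 lerDl sumr_ge0// => i _; rewrite -expr2 sqr_ge0.
Qed.

Lemma enorm_le_sum u : enorm u <= \sum_j `|u ord0 j|.
Proof.
rewrite {1}(_ : u = \sum_j u ord0 j *: delta_mx ord0 j); last exact: row_sum_delta.
apply: (big_ind2 (fun x y => enorm x <= y)).
- by rewrite enorm0.
- by move=> x1 x2 y1 y2 H1 H2; rewrite (le_trans (enormD _ _))// lerD.
- move=> j _; rewrite enormZ -[leRHS]mulr1 ler_wpM2l//.
  rewrite /enorm /dotv (bigD1 j)//= big1 => [|i ij]; rewrite !mxE !eqxx ?(negbTE ij) ?mul0r//.
  by rewrite mulr1 addr0 sqrtr1.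
Qed.

End dotv_theory.

Section vector_derivatives.
Variables (R : realType) (n : nat).
Implicit Types (z w : R -> 'rV[R]_n) (t : R) (b v u : 'rV[R]_n).

Lemma is_derive_coord z t v j :
  is_derive t 1 z v -> is_derive t 1 (fun s => z s ord0 j) (v ord0 j).
Proof.
move=> [dz <-]; apply: DeriveDef; first exact: (derivable_mxP _ _ _).1.
by rewrite derive_mx// mxE.
Qed.

Lemma coord_is_derive z t v :
  (forall j, is_derive t 1 (fun s => z s ord0 j) (v ord0 j)) -> is_derive t 1 z v.
Proof.
move=> H; have dz : derivable z t 1.
  by apply/derivable_mxP => i j; rewrite (ord1 i); case: (H j).
apply: DeriveDef => //; rewrite derive_mx//; apply/rowP => j; rewrite mxE.
by case: (H j).
Qed.

Lemma is_derive_dotv z w t v u : is_derive t 1 z v -> is_derive t 1 w u ->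
  is_derive t 1 (fun s => dotv (z s) (w s)) (dotv v (w t) + dotv (z t) u).
Proof.
move=> dz dw; rewrite /dotv -big_split/=.
have -> : (fun s => \sum_(j < n) z s ord0 j * w s ord0 j) =
    \sum_(j < n) (fun s => z s ord0 j * w s ord0 j).
  by apply/funext => s; rewrite fct_sumE.
apply: is_derive_sum => j.
have := is_deriveM (is_derive_coord j dz) (is_derive_coord j dw).
by rewrite /GRing.scale/= addrC [w t ord0 j * _]mulrC.
Qed.

Lemma is_derive_dotvl b z t v : is_derive t 1 z v ->
  is_derive t 1 (fun s => dotv b (z s)) (dotv b v).
Proof.
move=> dz; have := is_derive_dotv (is_derive_cst b t 1) dz.
by rewrite dotv0l add0r.
Qed.

Lemma is_derive_vderiv z t : derivable z t 1 -> is_derive t 1 z ('D_1 z t).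
Proof. by move=> dz; exact: DeriveDef. Qed.

End vector_derivatives.

(** * Normal cones of polyhedra, speed bound and moving selections *)

Section polyhedra.
Variables (R : realType) (n m : nat) (b : 'I_m -> 'rV[R]_n) (c : 'I_m -> R -> R).
Implicit Types (J : {set 'I_m}) (t : R) (r : 'I_m -> R).
Implicit Types (u v w x d : 'rV[R]_n) (z : R -> 'rV[R]_n).

Definition facet_mx J : 'M[R]_(m, n) :=
  \matrix_(i, j) (if i \in J then b i ord0 j else 0).

(** A solution [d] of the equations [dotv (b i) d = r i] for [i] in [J], whenever they are
    consistent. Being linear in [r], it turns Lipschitz right-hand sides into Lipschitz curves. *)
Definition facet_lift J r : 'rV[R]_n :=
  (\row_i (if i \in J then r i else 0)) *m pinvmx (facet_mx J)^T.

Lemma facet_mxE J v i :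
  (v *m (facet_mx J)^T) ord0 i = if i \in J then dotv (b i) v else 0.
Proof.
rewrite mxE; under eq_bigr do rewrite !mxE.
case: ifP => iJ; first by apply: eq_bigr => j _; rewrite mulrC.
by rewrite big1// => j _; rewrite mulr0.
Qed.

(** The [b i] may be dependent, so consistency is supplied by one solution [v]: it puts the
    right-hand side in the row space of the transposed matrix, where [pinvmx] inverts. *)
Lemma facet_liftE J r v : (forall i, i \in J -> r i = dotv (b i) v) ->
  forall i, i \in J -> dotv (b i) (facet_lift J r) = r i.
Proof.
move=> rv i iJ; rewrite /facet_lift.
have -> : \row_i (if i \in J then r i else 0) = v *m (facet_mx J)^T.
  by apply/rowP => k; rewrite facet_mxE mxE; case: ifP => // /rv.
have := mulmxKpV (submxMl v (facet_mx J)^T) => /(congr1 (fun M : 'rV_m => M ord0 i)).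
by rewrite !facet_mxE iJ rv.
Qed.

Lemma facet_liftB J r r' :
  facet_lift J r - facet_lift J r' = facet_lift J (fun i => r i - r' i).
Proof.
rewrite /facet_lift -mulmxBl; congr (_ *m _); apply/rowP => i; rewrite !mxE.
by case: ifP => // _; rewrite subrr.
Qed.

(** There are finitely many [J], so the sum over [J] of the entrywise norms of the pseudo-inverses
    is one constant for all of them. *)
Lemma facet_lift_bound : exists2 C : R, 0 <= C & forall J r (L : R),
  (forall i, i \in J -> `|r i| <= L) -> 0 <= L -> enorm (facet_lift J r) <= C * L.
Proof.
pose C J : R := \sum_j \sum_i `|pinvmx (facet_mx J)^T i j|.
have C0 J : 0 <= C J by apply: sumr_ge0 => j _; apply: sumr_ge0.
exists (\sum_J C J); first by apply: sumr_ge0.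
move=> J r L rL L0; apply: (@le_trans _ _ (C J * L)); last first.
  by rewrite ler_wpM2r// (bigD1 J)//= lerDl sumr_ge0.
apply: le_trans (enorm_le_sum _) _; rewrite mulr_suml ler_sum// => j _.
rewrite mxE (le_trans (ler_norm_sum _ _ _))// mulr_suml ler_sum// => i _.
rewrite normrM mulrC ler_wpM2l// mxE; case: ifP => [/rL//|_].
by rewrite normr0.
Qed.

Lemma polyhedron_move t x d : polyhedron b c t x ->
  (forall i, i \in active b c t x -> dotv (b i) d = 0) ->
  exists2 e : R, 0 < e & forall s, `|s| < e -> polyhedron b c t (x + s *: d).
Proof.
move=> Cx Hd.
have : \forall s \near (0 : R), forall i, dotv (b i) (x + s *: d) <= c i t.
  apply: (@filter_forall R 'I_m (fun i s => dotv (b i) (x + s *: d) <= c i t)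
    (nbhs (0 : R)) (nbhs_filter (0 : R))) => i.
  have [iA|iA] := boolP (i \in active b c t x).
    by apply: nearW => s; rewrite dotvDr dotvZr Hd// mulr0 addr0; exact: Cx.
  have lt_i : dotv (b i) x < c i t.
    by rewrite lt_neqAle Cx andbT; move: iA; rewrite inE.
  have dp : 0 < `|dotv (b i) d| + 1 by rewrite ltr_wpDl.
  apply/nbhs_ballP; exists ((c i t - dotv (b i) x) / (`|dotv (b i) d| + 1)).
    by rewrite /= divr_gt0// subr_gt0.
  move=> s; rewrite /ball/= sub0r normrN ltr_pdivlMr// => Hs.
  rewrite dotvDr dotvZr -lerBrDl; apply: le_trans (ltW Hs).
  by rewrite (le_trans (ler_norm _))// normrM ler_wpM2l// lerDl.
move=> /nbhs_ballP[e /= e0 He]; exists e => // s se i.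
by apply: He; rewrite /ball/= sub0r normrN.
Qed.

(** Small multiples of [d] of both signs keep the point in the polyhedron: active constraints do not
    change and the others have slack. Testing [v] with both signs gives equality. *)
Lemma normal_cone_orth t x v d : polyhedron b c t x ->
  normal_cone (polyhedron b c t) x v ->
  (forall i, i \in active b c t x -> dotv (b i) d = 0) -> dotv v d = 0.
Proof.
move=> Cx Nv Hd; have [e e0 He] := polyhedron_move Cx Hd.
have e2 : 0 < e / 2 by rewrite divr_gt0.
have lte : e / 2 < e by rewrite gtr_pMr// invf_lt1// ltr1n.
have := Nv _ (He (e / 2) _); have := Nv _ (He (- (e / 2)) _).
rewrite normrN gtr0_norm// => /(_ lte) H1 /(_ lte) H2; move: H1 H2.
rewrite ![_ + _ *: _ - _]addrAC subrr !add0r !dotvZr.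
by move=> H1 H2; apply/eqP; rewrite eq_le; apply/andP; split; nra.
Qed.

Lemma is_derive_min (f : R -> R) (t a : R) : is_derive t 1 f a ->
  (\forall s \near t, f t <= f s) -> a = 0.
Proof.
move=> fa /nbhs_ballP[r /= r0 Hr].
have [df Ef] := fa.
have [dg Eg] := is_deriveN fa.
apply/eqP; rewrite eq_le; apply/andP; split; apply/ler_addgt0Pr => e e0.
  have dgle : 'D_1 (- f) t <= - a by rewrite Eg.
  have [d d0 Hd] := straddle dg dgle e0.
  pose h := Num.min d r / 2.
  have h0 : 0 < h by rewrite /h divr_gt0// lt_min d0.
  have hd : h < d by rewrite /h ltr_pdivrMr// gt_min; apply/orP; left; lra.
  have hr : h < r by rewrite /h ltr_pdivrMr// gt_min; apply/orP; right; lra.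
  have := Hd (t - h) t; rewrite lerBlDr lerDl (ltW h0) lexx ltrDl d0 ltrD2l ltrN2 hd.
  move=> /(_ isT isT isT isT).
  have : f t <= f (t - h) by apply: Hr; rewrite /ball/= opprB addrC subrK gtr0_norm.
  have -> : (- f) t = - f t by [].
  have -> : (- f) (t - h) = - f (t - h) by [].
  have -> : t - (t - h) = h by ring.
  move=> H1 H2; have : 0 <= (- a + e) * h by apply: le_trans H2; lra.
  by rewrite pmulr_lge0//; lra.
have dfle : 'D_1 f t <= a by rewrite Ef.
have [d d0 Hd] := straddle df dfle e0.
pose h := Num.min d r / 2.
have h0 : 0 < h by rewrite /h divr_gt0// lt_min d0.
have hd : h < d by rewrite /h ltr_pdivrMr// gt_min; apply/orP; left; lra.
have hr : h < r by rewrite /h ltr_pdivrMr// gt_min; apply/orP; right; lra.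
have := Hd t (t + h); rewrite ltrBlDr ltrDl d0 lexx lerDl (ltW h0) ltrD2l hd.
move=> /(_ isT isT isT isT).
have : f t <= f (t + h).
  by apply: Hr; rewrite /ball/= opprD addrA subrr add0r normrN gtr0_norm.
have -> : t + h - t = h by ring.
move=> H1 H2; have : 0 <= (a + e) * h by apply: le_trans H2; lra.
by rewrite pmulr_lge0//; lra.
Qed.

(** The slack [c i s - dotv (b i) (z s)] is nonnegative on both sides of [t] and vanishes at [t], so
    its derivative vanishes there. *)
Lemma active_derive t z v i a : (\forall s \near t, polyhedron b c s (z s)) ->
  i \in active b c t (z t) -> is_derive t 1 z v -> is_derive t 1 (c i) a ->
  dotv (b i) v = a.
Proof.
move=> Cz iA dz dc; apply/esym/subr0_eq.
apply: (is_derive_min (is_deriveB dc (is_derive_dotvl (b i) dz))).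
apply: filterS Cz => s Cs.
move: iA; rewrite inE => /eqP it.
have -> : (c i - (fun s => dotv (b i) (z s))) t = 0.
  by apply/eqP; rewrite subr_eq0 it.
by rewrite subr_ge0; exact: Cs.
Qed.

(* The velocity is orthogonal to [w - v], since [w - v] is orthogonal to the
   active normals. *)
Lemma velocity_dot t z v w : (\forall s \near t, polyhedron b c s (z s)) ->
  is_derive t 1 z v -> normal_cone (polyhedron b c t) (z t) (- v) ->
  (forall i, i \in active b c t (z t) -> is_derive t 1 (c i) (dotv (b i) w)) ->
  dotv v v = dotv v w.
Proof.
move=> Cz dz Nz dc; have Ct := nbhs_singleton Cz.
have : dotv (- v) (w - v) = 0.
  apply: normal_cone_orth Ct Nz _ => i iA.
  by rewrite dotvBr (active_derive Cz iA dz (dc i iA)) subrr.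
by rewrite dotvNl dotvBr => /eqP; rewrite oppr_eq0 subr_eq0 => /eqP.
Qed.

Section lipschitz_constraints.
Variable L : R.
Hypothesis L0 : 0 < L.
Hypothesis cL : forall i (s t : R), `|c i s - c i t| <= L * `|s - t|.

(** The velocity [v] itself shows that the equations [dotv (b i) w = 'D_1 (c i) t] on the active set
    are consistent. The lift [w] has size at most [C * L], and [velocity_dot] with Cauchy-Schwarz
    gives [|v| <= |w|]. The bound depends neither on the curve nor on the time. *)
Lemma velocity_bound : exists2 K : R, 0 < K & forall t z v,
  (\forall s \near t, polyhedron b c s (z s)) ->
  is_derive t 1 z v -> normal_cone (polyhedron b c t) (z t) (- v) ->
  (forall i, derivable (c i) t 1) -> enorm v <= K.
Proof.
have [C C0 HC] := facet_lift_bound.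
exists (C * L + 1); first by rewrite ltr_wpDl// mulr_ge0// ltW.
move=> t z v Cz dz Nz dc.
pose J := active b c t (z t); pose r i := 'D_1 (c i) t.
have dcr i : is_derive t 1 (c i) (r i) by exact: DeriveDef.
pose w := facet_lift J r.
have vw : dotv v v = dotv v w.
  apply: (velocity_dot Cz dz Nz) => i iJ.
  rewrite (@facet_liftE J r v)// => k kJ.
  by rewrite (active_derive Cz kJ dz (dcr k)).
have wL : enorm w <= C * L.
  by apply: HC => [i _|]; [exact: klip_derive_le (ltW L0) (@cL i) (dcr i) | exact: ltW].
apply: (@le_trans _ _ (enorm w)); last by lra.
have [->|v0] := eqVneq v 0; first by rewrite enorm0 enorm_ge0.
have ev : 0 < enorm v.
  by rewrite lt_neqAle enorm_ge0 andbT eq_sym; apply: contraNneq v0 => /enorm0_eq0 ->.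
rewrite -(ler_pM2l ev) -expr2 enorm_sqr vw.
exact: le_trans (ler_norm _) (dotv_CS _ _).
Qed.

(** The lift moves [x] so as to follow the constraints active at [x]. Its displacement is at most
    [C * L * |s - t|], so the constraints with slack at [t] stay satisfied for a while. *)
Lemma lpaf_selection t x : LPAF b c t -> polyhedron b c t x ->
  let w s := x + facet_lift (active b c t x) (fun i => c i s - c i t) in
  \forall s \near t, polyhedron b c s (w s) /\
    forall i, i \in active b c t x -> dotv (b i) (w s) = c i s.
Proof.
move=> Lt Cx w; set J := active b c t x.
have [C C0 HC] := facet_lift_bound.
have wx s : enorm (w s - x) <= C * (L * `|s - t|).
  rewrite /w addrAC subrr add0r; apply: HC => [i _|]; first exact: cL.
  by rewrite mulr_ge0// ltW.
have active_eq : \forall s \near t, forall i, i \in J -> dotv (b i) (w s) = c i s.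
  apply: filterS Lt => s Fs i iJ.
  (* LPAF gives a point [y] of the polyhedron at time [s] with active set exactly [J], so [y - x]
     solves the equations of the lift. *)
  have [y Cy Jy] : active_family b c s J by rewrite Fs; exists x.
  rewrite /w dotvDr (@facet_liftE _ _ (y - x))// => [|k kJ].
    by move: iJ; rewrite inE => /eqP ->; rewrite addrC subrK.
  rewrite dotvBr; have : k \in active b c s y by rewrite Jy.
  by rewrite inE => /eqP ->; move: kJ; rewrite inE => /eqP ->.
have inactive_lt : \forall s \near t, forall i, i \notin J -> dotv (b i) (w s) <= c i s.
  apply: (@filter_forall R 'I_m (fun i s => i \notin J -> dotv (b i) (w s) <= c i s)
    (nbhs t) (nbhs_filter t)) => i.
  have [iJ|iJ] := boolP (i \in J); first exact: nearW.
  have gap : 0 < c i t - dotv (b i) x.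
    by rewrite subr_gt0 lt_neqAle Cx andbT; move: iJ; rewrite inE.
  (* [Q] bounds the rate at which the slack can shrink: the first term comes from the motion of [w],
     the second from that of [c i]. *)
  pose Q := enorm (b i) * C * L + L.
  have Q0 : 0 < Q by rewrite /Q ltr_wpDl// !mulr_ge0 ?enorm_ge0// ltW.
  apply/nbhs_ballP; exists ((c i t - dotv (b i) x) / Q); first by rewrite /= divr_gt0.
  move=> s; rewrite /ball/= distrC ltr_pdivlMr// => Hs _.
  have H1 := cL i t s; rewrite distrC [`|t - s|]distrC in H1.
  have H2 : dotv (b i) (w s - x) <= enorm (b i) * (C * (L * `|s - t|)).
    apply: le_trans (ler_norm _) _; apply: le_trans (dotv_CS _ _) _.
    by rewrite ler_wpM2l ?enorm_ge0.
  move: H2; rewrite dotvBr => H2.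
  have := ler_norm (- (c i s - c i t)); rewrite normrN.
  move: Hs; rewrite /Q; nra.
near=> s; split; last by near: s.
move=> i; have [iJ|iJ] := boolP (i \in J).
  by rewrite (near active_eq s).
by apply: (near inactive_lt s).
Unshelve. all: by end_near. Qed.

End lipschitz_constraints.
End polyhedra.

(** * Lipschitz curves *)

Lemma lebesgue_ae_forall (R : realType) (I : finType) (P : I -> R -> Prop) :
  (forall i, {ae lebesgue_measure, forall t, P i t}) ->
  {ae lebesgue_measure, forall t, forall i, P i t}.
Proof.
move=> H; apply: (@filter_forall _ I (fun i t => P i t)
  _ (ae_filter_ringOfSetsType lebesgue_measure)) => i; exact: H.
Qed.

Lemma lip_ae_derivable (R : realType) (f : R -> R) (K : R) : 0 < K ->
  (forall x y, `|f x - f y| <= K * `|x - y|) ->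
  {ae lebesgue_measure, forall t, derivable f t 1}.
Proof.
move=> K0 fK.
have H (k : nat) : {ae lebesgue_measure, forall x, - k%:R < x < k%:R -> derivable f x 1}.
  have [g [_ _ aeg _]] := lip_density (- k%:R) k%:R K0 fK.
  by apply: lebesgue_aeS aeg => x Hx /Hx [].
have H' := ae_foralln H.
apply: lebesgue_aeS H' => x Hx; apply: (Hx (Num.trunc `|x|).+1).
by rewrite -ltr_norml; exact: truncnS_gt.
Qed.

Section lipschitz_curves.
Variables (R : realType) (n : nat).
Implicit Types (h z : R -> 'rV[R]_n) (K a b t : R) (v : 'rV[R]_n).

Definition elip K h := forall s t, enorm (h s - h t) <= K * `|s - t|.

Lemma elip_coord K h j : elip K h ->
  forall s t, `|h s ord0 j - h t ord0 j| <= K * `|s - t|.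
Proof.
by move=> hK s t; have := coord_le_enorm (h s - h t) j; rewrite !mxE => /le_trans; apply.
Qed.

Lemma elip_ae_derivable K h : 0 < K -> elip K h ->
  {ae lebesgue_measure, forall t, derivable h t 1}.
Proof.
move=> K0 hK.
have H j : {ae lebesgue_measure, forall t, derivable (fun s => h s ord0 j) t 1}.
  exact: lip_ae_derivable K0 (elip_coord j hK).
apply: lebesgue_aeS (lebesgue_ae_forall H) => t Ht.
by apply/derivable_mxP => i j; rewrite (ord1 i).
Qed.

(** The scalar function [dotv v (h s)] is Lipschitz with constant [enorm v * K] and has derivative
    [enorm v ^+ 2] at [t]. *)
Lemma elip_derive K h t v : 0 <= K -> elip K h -> is_derive t 1 h v -> enorm v <= K.
Proof.
move=> K0 hK dh.
have [->|v0] := eqVneq v 0; first by rewrite enorm0.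
have ev : 0 < enorm v.
  by rewrite lt_neqAle enorm_ge0 andbT eq_sym; apply: contraNneq v0 => /enorm0_eq0 ->.
have lipv x y : `|dotv v (h x) - dotv v (h y)| <= (enorm v * K) * `|x - y|.
  rewrite -dotvBr (le_trans (dotv_CS _ _))// -mulrA ler_wpM2l ?enorm_ge0//; exact: hK.
have := klip_derive_le (mulr_ge0 (enorm_ge0 v) K0) lipv (is_derive_dotvl v dh).
by rewrite ger0_norm ?dotv_ge0// -enorm_sqr expr2 ler_pM2l.
Qed.

Lemma lip_scalar_ac (f : R -> R) (a b Q : R) : 0 <= Q ->
  (forall x y, a <= x -> x <= y -> y <= b -> `|f y - f x| <= Q * (y - x)) ->
  scalar_ac a b f.
Proof.
move=> Q0 fQ e e0; have Q1 : 0 < Q + 1 by rewrite ltr_wpDl.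
exists (e / (Q + 1)) => [|N x y xy _]; first by rewrite divr_gt0.
rewrite ltr_pdivlMr// => H; apply: le_lt_trans H; rewrite mulr_suml ler_sum// => k _.
have [/andP[ax xyk] yb] := xy k.
apply: le_trans (fQ _ _ ax xyk yb) _.
by rewrite mulrC ler_wpM2l ?subr_ge0// lerDl.
Qed.

Lemma sqr_derive_le K h a b M : 0 <= K -> elip K h -> a <= b ->
  {ae lebesgue_measure, forall t, a < t < b ->
    derivable h t 1 /\ 2 * dotv ('D_1 h t) (h t) <= M} ->
  dotv (h b) (h b) - dotv (h a) (h a) <= M * (b - a).
Proof.
move=> K0 hK ab aeh.
apply: (@ac_derive_le _ (fun t => dotv (h t) (h t))) => //; last first.
  apply: lebesgue_aeS aeh => t H /H[dh Hle].
  have [dd E] := is_derive_dotv (is_derive_vderiv dh) (is_derive_vderiv dh).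
  by split => //; rewrite E (dotvC (h t)) -mulr2n -mulr_natl.
(* On [[a, b]] the curve stays in the ball of radius [B], which makes its squared norm Lipschitz
   there. *)
pose B := enorm (h a) + K * (b - a).
have B0 : 0 <= B by rewrite /B addr_ge0 ?enorm_ge0// mulr_ge0// subr_ge0.
have hB t : a <= t <= b -> enorm (h t) <= B.
  move=> /andP[at_ tb]; have := enorm_sub_add (h a) (h t) 0; rewrite !subr0 => /le_trans; apply.
  rewrite /B addrC lerD2l; apply: le_trans (hK _ _) _.
  by rewrite ger0_norm ?subr_ge0// ler_wpM2l// lerD2r.
apply: (@lip_scalar_ac _ _ _ (K * (B + B))) => [|x y ax xy yb].
  by rewrite mulr_ge0// addr_ge0.
have -> : dotv (h y) (h y) - dotv (h x) (h x) = dotv (h y - h x) (h y + h x).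
  by rewrite dotvBl !dotvDr (dotvC (h x) (h y)); ring.
apply: le_trans (dotv_CS _ _) _; rewrite mulrAC ler_pM ?enorm_ge0//.
  by apply: le_trans (hK _ _) _; rewrite ger0_norm// subr_ge0.
apply: le_trans (enormD _ _) _; apply: lerD; apply: hB.
  by rewrite (le_trans ax).
by rewrite ax (le_trans xy).
Qed.

End lipschitz_curves.

Lemma elipB (R : realType) (n : nat) (K K' : R) (f g : R -> 'rV[R]_n) :
  elip K f -> elip K' g -> elip (K + K') (fun t => f t - g t).
Proof.
move=> fK gK s t.
have -> : f s - g s - (f t - g t) = (f s - f t) - (g s - g t).
  by rewrite !opprB addrACA [- g s + _]addrC -addrACA.
by rewrite (le_trans (enormB _ _))// mulrDl lerD.
Qed.

Lemma elip_cst (R : realType) (n : nat) (x : 'rV[R]_n) : elip 0 (fun=> x).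
Proof. by move=> s t; rewrite subrr enorm0 mul0r. Qed.

(** * Contraction, and rigidity when the distance is constant *)

Section sweeping.
Variables (R : realType) (n m : nat) (b : 'I_m -> 'rV[R]_n) (c : 'I_m -> R -> R).
Variable L : R.
Hypothesis L0 : 0 < L.
Hypothesis cL : forall i (s t : R), `|c i s - c i t| <= L * `|s - t|.
Implicit Types (a K s t : R) (f g z y : R -> 'rV[R]_n).
Let C := polyhedron b c.

(** The Lipschitz bound is global, also before [a], so that translates and densities need no care at
    the starting time. The inclusion is asked strictly after [a], where the derivative sees only
    feasible positions. *)
Definition sweeps_from a K z := [/\ elip K z,
  forall t, a <= t -> C t (z t) &
  {ae lebesgue_measure, forall t, a < t ->
    derivable z t 1 /\ normal_cone (C t) (z t) (- 'D_1 z t)}].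

Lemma near_above a z t : (forall t, a <= t -> C t (z t)) -> a < t ->
  \forall s \near t, C s (z s).
Proof.
move=> Cz at_.
have : t \in `]a, +oo[ by rewrite in_itv/= at_.
by move=> /near_in_itvoy; apply: filterS => s; rewrite in_itv/= andbT => /ltW /Cz.
Qed.

Lemma ae_derivable_c : {ae lebesgue_measure, forall t, forall i, derivable (c i) t 1}.
Proof.
by apply: lebesgue_ae_forall => i; exact: lip_ae_derivable L0 (cL i).
Qed.

(** Monotonicity of the normal cone: testing each inclusion with the position of the other solution
    makes the derivative of the squared distance nonpositive. *)
Lemma sweeps_contract a K f g s t : 0 <= K ->
  sweeps_from a K f -> sweeps_from a K g -> a <= s -> s <= t ->
  enorm (f t - g t) <= enorm (f s - g s).
Proof.
move=> K0 [fK Cf aef] [gK Cg aeg] as_ st.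
rewrite -ler_sqr ?nnegrE ?enorm_ge0// !enorm_sqr -subr_le0 -[leRHS](mul0r (t - s)).
apply: (@sqr_derive_le _ _ (K + K) (fun r => f r - g r)) => //; first exact: addr_ge0.
  exact: elipB.
apply: lebesgue_aeS (lebesgue_aeI aef aeg) => r [Hf Hg] /andP[sr rt].
have ar : a < r by exact: le_lt_trans sr.
have [df Nf] := Hf ar; have [dg Ng] := Hg ar.
have [dh Eh] := is_deriveB (is_derive_vderiv df) (is_derive_vderiv dg).
split; first exact: dh.
rewrite Eh; have := Nf _ (Cg _ (ltW ar)); have := Ng _ (Cf _ (ltW ar)).
move: ('D_1 f r) ('D_1 g r) (f r) (g r) => p q u v.
rewrite !dotvNl !dotvBr !dotvBl; lra.
Qed.

(** This is the equality case of the contraction. The velocities [p] and [q] turn out orthogonal to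
    [f r - g r], so [- p] and [- q] are also normal at the midpoint [x]. Constraints active at [x]
    are active at both ends and give [p] and [q] the same component; hence [p - q] is orthogonal to
    [p] and to [q], and vanishes. *)
Lemma sweeps_sub_cst a K f g : 0 <= K ->
  sweeps_from a K f -> sweeps_from a K g ->
  (forall t, a <= t -> enorm (f t - g t) = enorm (f a - g a)) ->
  forall t, a <= t -> f t - g t = f a - g a.
Proof.
move=> K0 [fK Cf aef] [gK Cg aeg] cst t at_.
pose h t := f t - g t - (f a - g a).
suff : dotv (h t) (h t) - dotv (h a) (h a) <= 0 * (t - a).
  rewrite mul0r /h subrr dotv0l subr0 => H.
  by apply/eqP; rewrite -subr_eq0; apply/eqP/dotv_eq0/le_anti; rewrite H dotv_ge0.
have hK : elip (K + K + 0) h by apply: elipB; [exact: elipB | exact: elip_cst].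
apply: (sqr_derive_le _ hK at_) => //; first by rewrite addr0 addr_ge0.
apply: lebesgue_aeS (lebesgue_aeI ae_derivable_c (lebesgue_aeI aef aeg)).
move=> r [dc [Hf Hg]] /andP[ar rt].
have [df Nf] := Hf ar; have [dg Ng] := Hg ar.
have Cfr := Cf _ (ltW ar); have Cgr := Cg _ (ltW ar).
move: (is_derive_vderiv df) Nf; move: ('D_1 f r) => p {}df Nf.
move: (is_derive_vderiv dg) Ng; move: ('D_1 g r) => q {}dg Ng.
have dfg := is_deriveB df dg.
have dh : is_derive r 1 h (p - q).
  by have := is_deriveB dfg (is_derive_cst (f a - g a) r 1); rewrite subr0.
have [dh1 Eh] := dh; split=> //; rewrite Eh.
suff -> : p - q = 0 by rewrite dotv0l mulr0.
have orth : dotv (p - q) (f r - g r) = 0.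
  have dphi := is_derive_dotv dfg dfg.
  have : is_derive r 1 (fun=> dotv (f a - g a) (f a - g a)) 0 by exact: is_derive_cst.
  have near_cst : \forall s \near r, dotv (f s - g s) (f s - g s) =
      dotv (f a - g a) (f a - g a).
    have : r \in `]a, +oo[ by rewrite in_itv/= ar.
    move=> /near_in_itvoy; apply: filterS => s; rewrite in_itv/= andbT => /ltW /cst E.
    by rewrite -!enorm_sqr E.
  have [_ E1] := near_eq_is_derive near_cst dphi.
  move=> [_]; rewrite E1 => E.
  have {}E : dotv (p - q) (f r - g r) +
    dotv (f r - g r) (p - q) = 0 := E.
  by move: E; rewrite (dotvC (f r - g r)); lra.
(* The two tests give opposite signs to quantities that [orth] makes equal, so both are zero. *)
have A := Nf _ Cgr; have B := Ng _ Cfr.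
have {A B} [A B] : dotv (p) (f r - g r) = 0 /\ dotv (q) (f r - g r) = 0.
  move: (f r) (g r) A B orth => u v; rewrite !dotvNl !dotvBr !dotvBl => A B E; split; lra.
pose x := 2^-1 *: (f r + g r).
have xE v : dotv v x = (dotv v (f r) + dotv v (g r)) / 2.
  by rewrite /x dotvZr dotvDr mulrC.
have Cx : C r x.
  by move=> i; rewrite xE; have := Cfr i; have := Cgr i; lra.
have active_f i : i \in active b c r x -> i \in active b c r (f r).
  rewrite !inE xE => /eqP E; apply/eqP; have := Cfr i; have := Cgr i; lra.
have active_g i : i \in active b c r x -> i \in active b c r (g r).
  rewrite !inE xE => /eqP E; apply/eqP; have := Cfr i; have := Cgr i; lra.
have Nfx : normal_cone (C r) x (- p).
  move=> u Cu; have := Nf u Cu; move: A; rewrite !dotvNl !dotvBr xE; lra.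
have Ngx : normal_cone (C r) x (- q).
  move=> u Cu; have := Ng u Cu; move: B; rewrite !dotvNl !dotvBr xE; lra.
have bd i : i \in active b c r x -> dotv (b i) (p - q) = 0.
  move=> iA; have dci : is_derive r 1 (c i) ('D_1 (c i) r) by exact: DeriveDef.
  have Ef := active_derive (near_above Cf ar) (active_f i iA) df dci.
  have Eg := active_derive (near_above Cg ar) (active_g i iA) dg dci.
  by rewrite dotvBr Ef Eg subrr.
have O1 := normal_cone_orth Cx Nfx bd; have O2 := normal_cone_orth Cx Ngx bd.
apply: dotv_eq0; rewrite dotvBl; move: O1 O2; rewrite !dotvNl; lra.
Qed.

End sweeping.

(** * Closure of solutions under uniform limits *)

Lemma dotv_sqr_close (R : realType) (n : nat) (p q : 'rV[R]_n) (e : R) :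
  enorm (p - q) <= e -> `|dotv p p - dotv q q| <= e * (2 * enorm q + e).
Proof.
move=> pqe; have -> : dotv p p - dotv q q = dotv (p - q) (p + q).
  by rewrite dotvBl !dotvDr (dotvC q p); ring.
apply: le_trans (dotv_CS _ _) _; apply: ler_pM => //; try exact: enorm_ge0.
have -> : p + q = (p - q) + (q + q) by rewrite addrA subrK.
apply: le_trans (enormD _ _) _; rewrite addrC lerD//.
by apply: le_trans (enormD _ _) _; rewrite mulr_natl mulr2n.
Qed.

Lemma right_quadratic_derive_le0 (R : realType) (f : R -> R) (t d M r : R) :
  is_derive t 1 f d -> 0 < r ->
  (forall h, 0 < h -> h < r -> f (t + h) - f t <= M * h * h) -> d <= 0.
Proof.
move=> fd r0 Hr; apply/ler_addgt0Pr => e e0; rewrite add0r.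
have [df Ef] := fd; have [dg Eg] := is_deriveN fd.
have e2 : 0 < e / 2 by rewrite divr_gt0.
have dgle : 'D_1 (- f) t <= - d by rewrite Eg.
have [s s0 Hs] := straddle dg dgle e2.
pose M' := `|M| + 1; have M'0 : 0 < M' by rewrite /M' ltr_wpDl.
pose h := Num.min (Num.min s r) (e / M') / 2.
have mn : 0 < Num.min (Num.min s r) (e / M') by rewrite !lt_min s0 r0 divr_gt0.
have h0 : 0 < h by rewrite /h divr_gt0.
have hmn : h < Num.min (Num.min s r) (e / M').
  by rewrite /h ltr_pdivrMr// mulr_natr mulr2n ltrDl.
have [hs hr] : h < s /\ h < r by move: hmn; rewrite !lt_min => /andP[/andP[]].
have hM : M' * h <= e / 2.
  rewrite /h mulrA ler_pM2r ?invr_gt0// mulrC -ler_pdivlMr// ge_min; apply/orP; right.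
  by rewrite lexx.
have := Hs t (t + h); rewrite ltrBlDr ltrDl s0 lexx lerDl (ltW h0) ltrD2l hs.
move=> /(_ isT isT isT isT).
have -> : (- f) t = - f t by [].
have -> : (- f) (t + h) = - f (t + h) by [].
have -> : t + h - t = h by ring.
move=> H1; have H2 := Hr h h0 hr.
have H3 : M * h <= M' * h.
  by rewrite ler_wpM2r ?(ltW h0)// (le_trans (ler_norm _))// lerDl.
have : 0 <= (M * h - (d - e / 2)) * h by nra.
rewrite pmulr_lge0//; lra.
Qed.

Section sweeping_closure.
Variables (R : realType) (n m : nat) (b : 'I_m -> 'rV[R]_n) (c : 'I_m -> R -> R).
Variable L : R.
Hypothesis L0 : 0 < L.
Hypothesis cL : forall i (s t : R), `|c i s - c i t| <= L * `|s - t|.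
Implicit Types (a K s t : R) (f g z y : R -> 'rV[R]_n).
Let C := polyhedron b c.

(** The inclusion is tested at [w s], since [x] may leave [C s]; replacing [x] by [w s] costs at
    most [K * Q * h] in the scalar product. The result mentions values of [f] but no derivative, so
    it passes to uniform limits. *)
Lemma sweeps_sqr_le a K Q f x (w : R -> 'rV[R]_n) t h : 0 <= K -> 0 <= Q -> 0 <= h ->
  sweeps_from b c a K f -> a <= t ->
  (forall s, t <= s -> s <= t + h -> C s (w s) /\ enorm (w s - x) <= Q * (s - t)) ->
  dotv (f (t + h) - x) (f (t + h) - x) - dotv (f t - x) (f t - x) <=
    2 * K * Q * h * h.
Proof.
move=> K0 Q0 h0 [fK Cf aef] at_ Hw.
have -> : 2 * K * Q * h * h = 2 * K * Q * h * (t + h - t) by ring.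
apply: (@sqr_derive_le _ _ (K + 0) (fun s => f s - x)).
- by rewrite addr0.
- by apply: elipB => //; exact: elip_cst.
- by rewrite lerDl.
apply: lebesgue_aeS aef => s H /andP[ts sh].
have as_ : a < s by exact: le_lt_trans ts.
have [df Nf] := H as_; have dfs := is_derive_vderiv df.
have pK := elip_derive K0 fK dfs.
have [dh Eh] := is_deriveB dfs (is_derive_cst x s 1).
split; first exact: dh.
rewrite Eh subr0; have [Cw wx] := Hw s (ltW ts) (ltW sh).
have H1 := Nf _ Cw.
have H2 := le_trans (ler_norm _) (dotv_CS ('D_1 f s) (w s - x)).
move: ('D_1 f s) (f s) (w s) H1 H2 pK wx => p u v; rewrite dotvNl.
have -> : dotv p (u - x) = dotv p (v - x) - dotv p (v - u) by rewrite !dotvBr; ring.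
move: (dotv p (v - x)) (dotv p (v - u)) => A B H1 H2 pK vx.
have : enorm p * enorm (v - x) <= K * (Q * (s - t)) by apply: ler_pM => //; exact: enorm_ge0.
have : K * (Q * (s - t)) <= K * (Q * h).
  by rewrite !ler_wpM2l// lerBlDl ltW.
lra.
Qed.

(** The velocities of the approximating solutions are not known to converge a.e., so the quadratic
    estimate [sweeps_sqr_le] is passed to the limit instead. At a time where [y] is differentiable,
    dividing it by [h] and letting [h] tend to 0 recovers the inclusion, tested at any [x] in
    [C t]. *)
Lemma sweeps_closed a K y : 0 < K ->
  {ae lebesgue_measure, forall t, LPAF b c t} -> elip K y ->
  (forall e, 0 < e -> exists2 f, sweeps_from b c a K f &
    forall t, a <= t -> enorm (f t - y t) <= e) ->
  sweeps_from b c a K y.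
Proof.
move=> K0 aeL yK yf; split=> //.
  move=> t at_ i; apply/ler_addgt0Pr => e e0.
  have B1 : 0 < enorm (b i) + 1 by rewrite ltr_wpDl ?enorm_ge0.
  have [|f [_ Cf _] fy] := yf (e / (enorm (b i) + 1)); first by rewrite divr_gt0.
  have := Cf t at_ i.
  have H1 : dotv (b i) (y t - f t) <= enorm (b i) * (e / (enorm (b i) + 1)).
    apply: le_trans (ler_norm _) _; apply: le_trans (dotv_CS _ _) _.
    by rewrite ler_wpM2l ?enorm_ge0// enorm_distC fy.
  have H2 : enorm (b i) * (e / (enorm (b i) + 1)) <= e.
    by rewrite mulrCA ler_piMr ?ltW// ltr_pdivrMr// mul1r ltrDl.
  by move: H1; rewrite dotvBr; lra.
apply: lebesgue_aeS (lebesgue_aeI aeL (elip_ae_derivable K0 yK)) => t [Lt dy] at_.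
split=> // x Cx; rewrite dotvNl.
pose w s := x + facet_lift b (active b c t x) (fun i => c i s - c i t).
have [r /= r0 Hr] := (nbhs_ballP _ _).1 (lpaf_selection L0 cL Lt Cx).
have [D D0 HD] := facet_lift_bound b.
have wx s : enorm (w s - x) <= D * L * `|s - t|.
  rewrite /w addrAC subrr add0r -mulrA; apply: HD => [i _|]; first exact: cL.
  by rewrite mulr_ge0// ltW.
have DL0 : 0 <= D * L by rewrite mulr_ge0// ltW.
have Q h : 0 < h -> h < r ->
  dotv (y (t + h) - x) (y (t + h) - x) - dotv (y t - x) (y t - x)
    <= 2 * K * (D * L) * h * h.
  move=> h0 hr; apply/ler_addgt0Pr => e e0.
  pose B1 := enorm (y (t + h) - x); pose B2 := enorm (y t - x).
  have B10 : 0 <= B1 by exact: enorm_ge0.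
  have B20 : 0 <= B2 by exact: enorm_ge0.
  (* As [e' <= 1], replacing [f] by [y] changes the two squares by at most [e' * (2 * B1 + 1)] and
     [e' * (2 * B2 + 1)], in total [e' * k]. *)
  pose k := 2 * B1 + 2 * B2 + 2; have k0 : 0 < k by rewrite /k; lra.
  pose e' := Num.min 1 (e / k).
  have e'0 : 0 < e' by rewrite lt_min ltr01 divr_gt0.
  have e'1 : e' <= 1 by rewrite ge_min lexx.
  have e'k : e' * k <= e by rewrite -ler_pdivlMr// ge_min lexx orbT.
  have [f swf fy] := yf e' e'0.
  have := @sweeps_sqr_le a K (D * L) f x w t h (ltW K0) DL0 (ltW h0) swf (ltW at_).
  have Hw s : t <= s -> s <= t + h -> C s (w s) /\ enorm (w s - x) <= D * L * (s - t).
    move=> ts sh; split; last by have := wx s; rewrite ger0_norm ?subr_ge0.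
    by apply: (Hr s _).1; rewrite /ball/= ltr_norml; lra.
  move=> /(_ Hw).
  have S1 : enorm (f (t + h) - x - (y (t + h) - x)) <= e'.
    by rewrite opprB addrA subrK; apply: fy; lra.
  have S2 : enorm (f t - x - (y t - x)) <= e'.
    by rewrite opprB addrA subrK; apply: fy; lra.
  have := dotv_sqr_close S1; have := dotv_sqr_close S2.
  rewrite !ler_norml -/B1 -/B2 => /andP[P1 P2] /andP[P3 P4] P5.
  move: e'k; rewrite /k => e'k.
  move: (dotv _ _) (dotv _ _) (dotv _ _) (dotv _ _) P1 P2 P3 P4 P5 => X1 X2 X3 X4 P1 P2 P3 P4 P5.
  nra.
have dyt := is_deriveB (is_derive_vderiv dy) (is_derive_cst x t 1).
have := right_quadratic_derive_le0 (is_derive_dotv dyt dyt) r0 Q.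
rewrite subr0 (dotvC _ ('D_1 y t)).
have -> : (y - cst x) t = y t - x by [].
move: ('D_1 y t) => p; rewrite !dotvBr; lra.
Qed.

End sweeping_closure.

(** * Solutions as Lipschitz curves, and their translates *)

Lemma shift_derivableE (R : realType) (n : nat) (z : R -> 'rV[R]_n) (s t : R) :
  (derivable (fun r => z (r + s)) t 1 = derivable z (t + s) 1) *
  ('D_1 (fun r => z (r + s)) t = 'D_1 z (t + s)).
Proof.
have E : (fun h : R => h^-1 *: (((fun r => z (r + s)) \o shift t) (h *: 1) - z (t + s))) =
  (fun h : R => h^-1 *: ((z \o shift (t + s)) (h *: 1) - z (t + s))).
  by apply/funext => h /=; rewrite addrA.
by split; rewrite /derivable /derive E.
Qed.

Lemma compact_frequently_near (R : realType) (n : nat) (A : set 'rV[R]_n)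
    (u : nat -> 'rV[R]_n) : compact A -> (forall q, A (u q)) ->
  exists x, forall e N, 0 < e -> exists2 q, (N <= q)%N & enorm (u q - x) < e.
Proof.
move=> cA Au.
have [|x [_ clx]] := cA (u @ \oo) _; first by exists 0%N => // q _; exact: Au.
exists x => e N e0.
(* The Euclidean norm is at most [n] times the sup norm that defines the balls; the added 1 covers
   [n = 0]. *)
pose k : R := n%:R + 1; have k0 : 0 < k by rewrite /k ltr_wpDl.
have ek0 : 0 < e / k by rewrite divr_gt0.
have [|_ [[q /= Nq <-] Bq]] := clx [set u q | q in [set q | (N <= q)%N]] (ball x (e / k)) _ (nbhsx_ballx _ _ ek0).
  by exists N => // q /= Nq; exists q.
exists q => //; apply: le_lt_trans (enorm_le_sum _) _.
have H j : `|(u q - x) ord0 j| <= `|x - u q|.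
  rewrite distrC [leRHS]/Num.Def.normr/= mx_normrE.
  exact: (le_bigmax _ _ (ord0, j)).
apply: (@le_lt_trans _ _ (\sum_(j < n) `|x - u q|)); first exact: ler_sum.
rewrite sumr_const card_ord -mulr_natl.
move: Bq; rewrite -ball_normE /= => Bq.
apply: (@le_lt_trans _ _ (k * `|x - u q|)); first by rewrite ler_wpM2r// /k lerDl.
by rewrite mulrC -ltr_pdivlMr.
Qed.

Section solutions.
Variables (R : realType) (n m : nat) (b : 'I_m -> 'rV[R]_n) (c : 'I_m -> R -> R).
Variable L : R.
Hypothesis L0 : 0 < L.
Hypothesis cL : forall i (s t : R), `|c i s - c i t| <= L * `|s - t|.
Let C := polyhedron b c.

(** The speed bound turns absolute continuity into a Lipschitz estimate. Freezing [z] at its initial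
    value before [t0] extends that estimate to the whole line. *)
Lemma solution_sweeps_from (t0 : R) (z : R -> 'rV[R]_n) :
  sweeping_solution C `[t0, +oo[ z ->
  exists2 K : R, 0 < K & sweeps_from b c t0 K (fun t => z (Num.max t t0)).
Proof.
move=> [acz Cz aez].
have {}Cz t : t0 <= t -> C t (z t) by move=> t0t; apply: Cz; rewrite in_itv/= t0t.
have [K K0 HK] := velocity_bound b L0 cL; exists K => //.
have lipz s t : t0 <= s -> s <= t -> enorm (z t - z s) <= K * (t - s).
  (* The scalar mean value inequality is applied in the direction [e] of the increment to be
     bounded. *)
  move=> t0s st; set e := z t - z s.
  have ac : scalar_ac s t (fun r => dotv e (z r)).
    move=> r r0; have e1 : 0 < enorm e + 1 by rewrite ltr_wpDl ?enorm_ge0.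
    have [|||d d0 Hd] := acz s t _ _ (r / (enorm e + 1)).
    - by rewrite in_itv/= t0s.
    - by rewrite in_itv/= (le_trans t0s).
    - by rewrite divr_gt0.
    exists d => // N x y xy tri xyd; have := Hd N x y xy tri xyd.
    rewrite ltr_pdivlMr//; apply: le_lt_trans; rewrite mulr_suml ler_sum// => k _.
    rewrite -dotvBr mulrC; apply: le_trans (dotv_CS _ _) _.
    by rewrite ler_wpM2r ?enorm_ge0// lerDl.
  have := @ac_derive_le _ _ s t (enorm e * K) st ac.
  rewrite -dotvBr -/e -enorm_sqr.
  have ae1 : {ae lebesgue_measure, forall r, s < r < t ->
      derivable (fun r => dotv e (z r)) r 1 /\
      'D_1 (fun r => dotv e (z r)) r <= enorm e * K}.
    apply: lebesgue_aeS (lebesgue_aeI (ae_derivable_c L0 cL) aez).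
    move=> r [dc Hr] /andP[sr rt].
    have t0r : t0 < r by exact: le_lt_trans sr.
    have [|dz Nz] := Hr; first by rewrite in_itv/= ltW.
    have dzr := is_derive_vderiv dz; have [dd E] := is_derive_dotvl e dzr.
    split=> //; rewrite E; apply: le_trans (ler_norm _) _.
    apply: le_trans (dotv_CS _ _) _; rewrite ler_wpM2l ?enorm_ge0//.
    exact: HK (near_above Cz t0r) dzr Nz dc.
  move=> /(_ ae1); have [->|e0] := eqVneq (enorm e) 0.
    by move=> _; rewrite mulr_ge0 ?(ltW K0) ?subr_ge0.
  have ep : 0 < enorm e by rewrite lt_neqAle eq_sym e0 enorm_ge0.
  by rewrite -mulrA expr2 ler_pM2l.
have maxE t : t0 <= t -> Num.max t t0 = t by move=> ?; rewrite max_l.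
split.
- have H s t : s <= t ->
      enorm (z (Num.max t t0) - z (Num.max s t0)) <= K * (t - s).
    move=> st; apply: (le_trans (lipz _ _ _ _)); first by rewrite le_max lexx orbT.
      by rewrite le_max2.
    rewrite ler_pM2l// !maxEle.
    by case: ifP; case: ifP => //; lra.
  move=> s t; have [st|/ltW ts] := leP s t.
    by rewrite enorm_distC distrC ger0_norm ?subr_ge0//; exact: H.
  by rewrite ger0_norm ?subr_ge0//; exact: H.
- by move=> t t0t; rewrite maxE//; exact: Cz.
- apply: lebesgue_aeS aez => t Ht t0t.
  have [|dz Nz] := Ht; first by rewrite in_itv/= ltW.
  have zE : \forall s \near t, z s = z (Num.max s t0).
    have : t \in `]t0, +oo[ by rewrite in_itv/= t0t.
    move=> /near_in_itvoy; apply: filterS => s; rewrite in_itv/= andbT => /ltW t0s.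
    by rewrite maxE.
  have [dZ ->] := near_eq_is_derive zE (is_derive_vderiv dz).
  by split => //; rewrite maxE// ltW.
Qed.

Section periodic_constraints.
Variable T : R.
Hypothesis T0 : 0 < T.
Hypothesis cT : forall i, periodic (c i) T.

Lemma periodicMn (V : Type) (f : R -> V) q t : (forall t, f (t + T) = f t) ->
  f (t + T *+ q) = f t.
Proof.
by move=> fT; elim: q => [|q IHq]; rewrite ?mulr0n ?addr0// mulrSr addrA fT.
Qed.

Lemma polyhedron_periodic q t : C (t + T *+ q) = C t.
Proof.
apply/seteqP; split=> x Cx i; have := Cx i.
  by rewrite periodicMn//; exact: cT.
by rewrite (@periodicMn _ (c i))//; exact: cT.
Qed.

Lemma sweeps_shift a K z q : sweeps_from b c a K z ->
  sweeps_from b c (a - T *+ q) K (fun t => z (t + T *+ q)).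
Proof.
move=> [zK Cz aez]; split.
- by move=> s t; apply: le_trans (zK _ _) _; rewrite opprD addrACA subrr addr0.
- move=> t; rewrite lerBlDr => /Cz; rewrite -/C polyhedron_periodic; exact.
- apply: lebesgue_aeS (lebesgue_ae_shift (T *+ q) aez) => t Ht.
  rewrite ltrBlDr => /Ht; rewrite !shift_derivableE.
  by rewrite -[polyhedron b c (t + _)]/(C (t + T *+ q)) polyhedron_periodic.
Qed.

Lemma sweeps_fromW a a' K z : a <= a' -> sweeps_from b c a K z -> sweeps_from b c a' K z.
Proof.
move=> aa' [zK Cz aez]; split=> // [t a't|]; first exact/Cz/(le_trans aa').
by apply: lebesgue_aeS aez => t Ht a't; apply/Ht/(le_lt_trans aa').
Qed.

End periodic_constraints.
End solutions.

(** * Uniform convergence to a periodic curve *)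

Section periodic_limit.
Variables (R : realType) (n m : nat) (b : 'I_m -> 'rV[R]_n) (c : 'I_m -> R -> R).
Variables L T : R.
Hypothesis L0 : 0 < L.
Hypothesis cL : forall i (s t : R), `|c i s - c i t| <= L * `|s - t|.
Hypothesis T0 : 0 < T.
Hypothesis cT : forall i, periodic (c i) T.
Let C := polyhedron b c.
Hypothesis Ccompact : forall t, compact (C t).
Hypothesis aeLPAF : {ae lebesgue_measure, forall t, LPAF b c t}.
Variables (t0 K : R) (z : R -> 'rV[R]_n).
Hypothesis K0 : 0 < K.
Hypothesis zsw : sweeps_from b c t0 K z.

Let Tn0 q : 0 <= T *+ q. Proof. by rewrite mulrn_wge0 // ltW. Qed.

Let shift_sw q : sweeps_from b c t0 K (fun t => z (t + T *+ q)).
Proof.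
apply: (@sweeps_fromW _ _ _ _ _ (t0 - T *+ q)); first by rewrite lerBlDr lerDl.
exact: sweeps_shift.
Qed.

Lemma periodic_limit : exists y : R -> 'rV[R]_n,
  [/\ sweeps_from b c t0 K y, forall t, t0 <= t -> y (t + T) = y t &
   forall e, 0 < e -> \forall q \near \oo, forall t, t0 <= t ->
     enorm (z (t + T *+ q) - y t) <= e].
Proof.
have [_ Cz _] := zsw.
have Cq q t : t0 <= t -> C t (z (t + T *+ q)) by have [_ H _] := shift_sw q; exact: H.
have [x0 Hx0] := compact_frequently_near (@Ccompact t0) (fun q => Cq q t0 (lexx t0)).
pose eps (k : nat) : R := k.+1%:R^-1.
have eps0 k : 0 < eps k by rewrite invr_gt0.
have epsle k l : (k <= l)%N -> eps l <= eps k.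
  by move=> kl; rewrite lef_pV2 ?posrE// ler_nat.
have eps_small e : 0 < e -> exists k, eps k <= e.
  move=> e0; have [k _ Hk] := near_infty_natSinv_lt (PosNum e0).
  by exists k; apply: ltW; apply: Hk => /=.
(* [phi] is not claimed to be increasing: [k <= phi k] is all that is used. Closeness at [t0]
   spreads to all later times by contraction, which gives [zphi]. *)
have /boolp.choice[phi Hphi] : forall k, exists q, (k <= q)%N /\
    enorm (z (t0 + T *+ q) - x0) < eps k.
  move=> k; have [q kq Hq] := Hx0 (eps k) k (eps0 k).
  by exists q.
have zphi k l t : (k <= l)%N -> t0 <= t ->
    enorm (z (t + T *+ phi k) - z (t + T *+ phi l)) <= 2 * eps k.
  move=> kl t0t.
  apply: le_trans (sweeps_contract (ltW K0) (shift_sw (phi k)) (shift_sw (phi l)) (lexx t0) t0t) _.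
  apply: le_trans (enorm_sub_add x0 _ _) _; rewrite [enorm (x0 - _)]enorm_distC.
  have [_ H1] := Hphi k; have [_ H2] := Hphi l; have := epsle _ _ kl; lra.
have maxt t : t0 <= Num.max t t0 by rewrite le_max lexx orbT.
(* [y t] is chosen as a cluster point for each [t] separately; [zphi] then makes it a limit, with a
   rate that does not depend on [t]. *)
have /boolp.choice[y Hy] : forall t, exists yt : 'rV[R]_n, forall e N, 0 < e ->
    exists2 l, (N <= l)%N & enorm (z (Num.max t t0 + T *+ phi l) - yt) < e.
  move=> t.
  exact: compact_frequently_near (@Ccompact (Num.max t t0)) (fun l => Cq (phi l) _ (maxt t)).
have zy k t : enorm (z (Num.max t t0 + T *+ phi k) - y t) <= 2 * eps k.
  apply/ler_addgt0Pr => e e0; have [l kl Hl] := Hy t e k e0.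
  apply: le_trans (enorm_sub_add (z (Num.max t t0 + T *+ phi l)) _ _) _.
  by apply: lerD; [exact: zphi | exact: ltW].
have zy' k t : t0 <= t -> enorm (z (t + T *+ phi k) - y t) <= 2 * eps k.
  by move=> t0t; have := zy k t; rewrite max_l.
have yK : elip K y.
  move=> s t; apply/ler_addgt0Pr => e e0.
  have [k Hk] := eps_small (e / 4) ltac:(by rewrite divr_gt0).
  apply: le_trans (enorm_sub_add (z (Num.max s t0 + T *+ phi k)) _ _) _.
  have := enorm_sub_add (z (Num.max t t0 + T *+ phi k)) (z (Num.max s t0 + T *+ phi k)) (y t).
  have := zy k s; rewrite enorm_distC; have := zy k t.
  have [zK _ _] := shift_sw (phi k).
  have := zK (Num.max s t0) (Num.max t t0).
  have : K * `|Num.max s t0 - Num.max t t0| <= K * `|s - t|.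
    rewrite ler_pM2l//; have N1 := ler_norm (s - t).
    have N2 := ler_norm (t - s); rewrite distrC in N2.
    by rewrite !maxEle; case: (leP s t0) => H1; case: (leP t t0) => H2;
      apply/ler_normlP; split; lra.
  lra.
have ysw : sweeps_from b c t0 K y.
  apply: (sweeps_closed L0 cL K0 aeLPAF yK) => e e0.
  have [k Hk] := eps_small (e / 2) ltac:(by rewrite divr_gt0).
  exists (fun t => z (t + T *+ phi k)); first exact: shift_sw.
  by move=> t t0t; apply: le_trans (zy' k t t0t) _; lra.
have ysw1 : sweeps_from b c t0 K (fun t => y (t + T)).
  apply: (@sweeps_fromW _ _ _ _ _ (t0 - T *+ 1)); first by rewrite lerBlDr lerDl ltW.
  exact: (@sweeps_shift _ _ _ _ _ _ cT _ _ _ 1 ysw).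
(* [g] is nonincreasing, and its values at [t + T *+ phi k] tend to [dl t]. So every [dl t] is the
   limit of [g] at infinity; [dl_ge] is the inequality that contraction does not already give. *)
pose g r := enorm (z (r + T) - z r).
have gle r s : t0 <= r -> r <= s -> g s <= g r.
  exact: sweeps_contract (ltW K0) (shift_sw 1) zsw.
pose dl t := enorm (y (t + T) - y t).
have dl_g t k : t0 <= t -> dl t <= g (t + T *+ phi k) + 4 * eps k
   /\ g (t + T *+ phi k) <= dl t + 4 * eps k.
  move=> t0t; have H1 := zy' k t t0t.
  have H2 := zy' k (t + T) ltac:(by rewrite ler_wpDr// ltW).
  rewrite /g [t + T *+ phi k + T]addrAC /dl.
  move: (y (t + T)) (y t) (z _) (z _) H1 H2 => p q v u H1 H2.
  have := enorm_sub_add v p q; have := enorm_sub_add u v q.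
  have := enorm_sub_add p v u; have := enorm_sub_add q p u.
  rewrite (enorm_distC p v) (enorm_distC q u); move: H1 H2; lra.
have dl_ge s t : t0 <= s -> s <= t -> dl s <= dl t.
  move=> t0s st; have t0t : t0 <= t by exact: le_trans st.
  apply/ler_addgt0Pr => e e0.
  have [k Hk] := eps_small (e / 8) ltac:(by rewrite divr_gt0).
  (* [l] is large enough for [phi l] periods after [s] to come later than [phi k] periods after [t],
     which is where monotonicity of [g] applies. *)
  pose l := maxn k (phi k + (Num.trunc ((t - s) / T)).+1)%N.
  have kl : (k <= l)%N by rewrite leq_maxl.
  have tsl : t + T *+ phi k <= s + T *+ phi l.
    have H1 : (t - s) / T <= ((Num.trunc ((t - s) / T)).+1)%:R by rewrite ltW// truncnS_gt.
    rewrite ler_pdivrMr// mulr_natl in H1.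
    have H2 : T *+ (phi k + (Num.trunc ((t - s) / T)).+1) <= T *+ phi l.
      rewrite ler_wpMn2l ?ltW//; have [+ _] := Hphi l; apply: leq_trans.
      by rewrite leq_maxr.
    by move: H2; rewrite mulrnDr; lra.
  have [D1 _] := dl_g s l t0s; have [_ D2] := dl_g t k t0t.
  have t0k : t0 <= t + T *+ phi k by rewrite ler_wpDr.
  have := gle _ _ t0k tsl; have := epsle _ _ kl; lra.
have ycst : forall t, t0 <= t -> y (t + T) - y t = y (t0 + T) - y t0.
  apply: (sweeps_sub_cst L0 cL (ltW K0) ysw1 ysw) => t t0t.
  apply/le_anti; rewrite -/(dl t) -/(dl t0) (dl_ge t0 t)// andbT.
  exact: sweeps_contract (ltW K0) ysw1 ysw (lexx _) t0t.
set v := y (t0 + T) - y t0 in ycst.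
have yv j : y (t0 + T *+ j) = y t0 + v *+ j.
  elim: j => [|j IHj]; first by rewrite !mulr0n !addr0.
  rewrite mulrSr addrA mulrSr addrA -IHj.
  have := ycst (t0 + T *+ j) ltac:(by rewrite ler_wpDr).
  by move/eqP; rewrite subr_eq => /eqP ->; rewrite addrC.
have v0 : v = 0.
  have [_ Cy _] := ysw.
  (* The arithmetic progression with step [v] stays in one compact set. Two of its terms whose
     indices differ by at least [M] lie within distance 2 of each other, so [M * enorm v <= 2]. *)
  have Cyj j : C t0 (y t0 + v *+ j).
    rewrite -yv /C -(polyhedron_periodic b cT j); exact/Cy/ler_wpDr.
  have [x Hx] := compact_frequently_near (@Ccompact t0) Cyj.
  apply: enorm0_eq0; apply/le_anti; rewrite enorm_ge0 andbT.
  apply/ler_addgt0Pr => e e0; rewrite add0r.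
  have [q1 _ H1] := Hx 1 0%N ltr01.
  pose M := (Num.trunc (2 / e)).+1.
  have [q2 q12 H2] := Hx 1 (q1 + M)%N ltr01.
  have E : enorm (v *+ (q2 - q1)) <= 2.
    have -> : v *+ (q2 - q1) = (y t0 + v *+ q2) - (y t0 + v *+ q1).
      rewrite opprD addrACA subrr add0r mulrnBr// (leq_trans _ q12)//.
      exact: leq_addr.
    apply: le_trans (enorm_sub_add x _ _) _; rewrite [enorm (x - _)]enorm_distC; lra.
  have M2 : 2 / e <= M%:R by rewrite ltW// truncnS_gt.
  have qM : (M%:R : R) <= (q2 - q1)%:R.
    by rewrite ler_nat leq_subRL ?(leq_trans _ q12)// leq_addr.
  move: E; rewrite -scaler_nat enormZ ger0_norm// => E.
  have M0 : (0 : R) < M%:R by rewrite ltr0n.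
  have : M%:R * enorm v <= M%:R * e.
    apply: le_trans (_ : 2 <= _); last by rewrite -ler_pdivrMr.
    by apply: le_trans E; rewrite ler_wpM2r ?enorm_ge0.
  by rewrite ler_pM2l.
have yT t : t0 <= t -> y (t + T) = y t.
  by move=> /ycst; rewrite v0 => /eqP; rewrite subr_eq0 => /eqP.
exists y; split=> // e e0.
have [k Hk] := eps_small (e / 2) ltac:(by rewrite divr_gt0).
exists (phi k) => // q /= kq t t0t.
have yTj j : y (t + T *+ j) = y t.
  elim: j => [|j IHj]; first by rewrite mulr0n addr0.
  by rewrite mulrSr addrA yT// ler_wpDr.
(* Periodicity of [y] lets the surplus periods [q - phi k] be absorbed into the time, so the
   estimate for [phi k] alone covers all later [q]. *)
rewrite -(yTj (q - phi k)%N) -(subnK kq) mulrnDr addrA addnK.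
apply: le_trans (zy' k _ _) _; first by rewrite ler_wpDr.
lra.
Qed.

End periodic_limit.

Lemma elip_abs_continuous (R : realType) (n : nat) (K a b : R) (f : R -> 'rV[R]_n) :
  0 <= K -> elip K f -> abs_continuous a b f.
Proof.
move=> K0 fK e e0; have K1 : 0 < K + 1 by rewrite ltr_wpDl.
exists (e / (K + 1)) => [|N x y xy _]; first by rewrite divr_gt0.
rewrite ltr_pdivlMr// => H; apply: le_lt_trans H; rewrite mulr_suml ler_sum// => k _.
have [/andP[_ xyk] _] := xy k.
apply: le_trans (fK _ _) _; rewrite ger0_norm ?subr_ge0//.
by rewrite mulrC ler_wpM2l ?subr_ge0// lerDl.
Qed.

(** * Periodic extension to the whole line *)

Lemma periodic_extension (R : realType) (n m : nat) (b : 'I_m -> 'rV[R]_n)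
    (c : 'I_m -> R -> R) (T t0 K : R) (y : R -> 'rV[R]_n) :
  0 < T -> (forall i, periodic (c i) T) -> 0 < K -> sweeps_from b c t0 K y ->
  (forall t, t0 <= t -> y (t + T) = y t) ->
  exists zbar : R -> 'rV[R]_n,
    [/\ sweeping_solution (polyhedron b c) `]-oo, +oo[ zbar,
        periodic zbar T, elip K zbar & forall t, t0 <= t -> zbar t = y t].
Proof.
move=> T0 cT K0 [yK Cy aey] yT.
have Tn0 q : 0 <= T *+ q by rewrite mulrn_wge0// ltW.
have yTn j t : t0 <= t -> y (t + T *+ j) = y t.
  move=> t0t; elim: j => [|j IHj]; first by rewrite mulr0n addr0.
  by rewrite mulrSr addrA yT// ler_wpDr.
(* A number of periods that brings [t] beyond [t0]; by [zE], any other sufficient number gives the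
   same value. *)
pose N t := (Num.trunc (`|t0 - t| / T)).+1.
have HN t k : (N t <= k)%N -> t0 <= t + T *+ k.
  move=> Nk; have H1 : `|t0 - t| / T <= (N t)%:R by rewrite ltW// truncnS_gt.
  rewrite ler_pdivrMr// mulr_natl in H1.
  have H2 : T *+ N t <= T *+ k by rewrite ler_wpMn2l ?ltW.
  have := ler_norm (t0 - t); lra.
pose zbar t := y (t + T *+ N t).
have zE t k : t0 <= t + T *+ k -> zbar t = y (t + T *+ k).
  move=> tk; have Nt := HN t _ (leqnn _); rewrite /zbar.
  have [kN|/ltnW Nk] := leqP k (N t).
    by rewrite -(subnKC kN) mulrnDr addrA yTn.
  by apply: esym; rewrite -[in LHS](subnKC Nk) mulrnDr addrA yTn.
have zK : elip K zbar.
  move=> s t; pose k := maxn (N s) (N t).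
  rewrite (zE s k) ?(zE t k) ?HN ?leq_maxl ?leq_maxr//.
  by apply: le_trans (yK _ _) _; rewrite opprD addrACA subrr addr0.
exists zbar; split => //; first split.
- by move=> u v _ _; exact: elip_abs_continuous (ltW K0) zK.
- move=> t _; have Nt := HN t _ (leqnn _).
  by rewrite -(polyhedron_periodic b cT (N t)) /zbar; exact: Cy.
(* The shift [N t] depends on [t], so the inclusion is proved a.e. for each fixed shift and the
   countably many null sets are united. *)
- have H k : {ae lebesgue_measure, forall t, t0 < t + T *+ k ->
    derivable zbar t 1 /\ normal_cone (polyhedron b c t) (zbar t) (- 'D_1 zbar t)}.
    apply: lebesgue_aeS (lebesgue_ae_shift (T *+ k) aey) => t Ht t0t.
    have [dy Ny] := Ht t0t; rewrite -!shift_derivableE in dy Ny.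
    have near_zE : \forall s \near t, y (s + T *+ k) = zbar s.
      have : t \in `]t0 - T *+ k, +oo[ by rewrite in_itv/= ltrBlDr t0t.
      move=> /near_in_itvoy; apply: filterS => s; rewrite in_itv/= andbT ltrBlDr => /ltW t0s.
      by rewrite (zE s k).
    have [dz Ez] := near_eq_is_derive near_zE (is_derive_vderiv dy).
    split=> //; rewrite Ez (zE t k) ?(ltW t0t)//.
    by rewrite -(polyhedron_periodic b cT k).
  have H' := ae_foralln H; apply: lebesgue_aeS H' => t Ht _.
  (* One more period makes the inequality with [t0] strict. *)
  apply: (Ht (N t).+1); rewrite mulrSr addrA.
  by apply: le_lt_trans (HN t _ (leqnn _)) _; rewrite ltrDl.
- move=> t; have Nt := HN t _ (leqnn _); rewrite (zE (t + T) (N t)); last by rewrite addrAC ler_wpDr// ltW.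
  by rewrite /zbar addrAC yT.
- by move=> t t0t; rewrite (zE t 0%N) mulr0n addr0.
Qed.

(** * Strong convergence of the velocities *)

Lemma bounded_Rintegral_itvD (R : realType) (f : R -> R) (M u v w : R) :
  u <= v -> v <= w -> measurable_fun setT f -> (forall x, `|f x| <= M) ->
  \int[lebesgue_measure]_(x in `[u, w]) f x =
  \int[lebesgue_measure]_(x in `[u, v]) f x +
  \int[lebesgue_measure]_(x in `[v, w]) f x.
Proof.
move=> uv vw mf fM.
have fi s t : lebesgue_measure.-integrable `[s, t] (EFin \o f).
  exact: bounded_itv_integrable mf fM.
have oc : lebesgue_measure.-integrable `]v, w] (EFin \o f).
  apply: integrableS (fi v w) => //.
  by move=> x; rewrite /= !in_itv/= => /andP[/ltW -> ->].
have := Rintegral_itvB (fi u w) (x := v); rewrite !bnd_simp => /(_ uv vw) H.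
by apply/eqP; rewrite addrC -subr_eq H; apply/eqP; exact: Rintegral_itv_obnd_cbnd.
Qed.

Lemma bounded_Rintegral_sum (R : realType) (I : finType) (f : I -> R -> R) (M u v : R) :
  (forall i, measurable_fun setT (f i)) -> (forall i x, `|f i x| <= M) ->
  \int[lebesgue_measure]_(x in `[u, v]) (\sum_i f i x) =
  \sum_i \int[lebesgue_measure]_(x in `[u, v]) f i x.
Proof.
move=> mf fM; elim: (index_enum I) => [|i s IHs].
  rewrite big_nil; under eq_Rintegral do rewrite big_nil.
  by rewrite Rintegral_cst// mul0r.
rewrite big_cons -IHs -RintegralD//; last 2 first.
- exact: bounded_itv_integrable (mf i) (fM i).
- apply: (bounded_itv_integrable (M := \sum_(j <- s) M)); first exact: measurable_sum.
  by move=> x; rewrite (le_trans (ler_norm_sum _ _ _))// ler_sum.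
by apply: eq_Rintegral => x _; rewrite big_cons.
Qed.

Section strong_convergence.
Variables (R : realType) (n m : nat) (b : 'I_m -> 'rV[R]_n) (c : 'I_m -> R -> R).
Variable L : R.
Hypothesis L0 : 0 < L.
Hypothesis cL : forall i (s t : R), `|c i s - c i t| <= L * `|s - t|.
Hypothesis aeLPAF : {ae lebesgue_measure, forall t, LPAF b c t}.
Let C := polyhedron b c.
Variables (t0 B K : R) (zq : nat -> R -> 'rV[R]_n) (y : R -> 'rV[R]_n).
Hypothesis K0 : 0 < K.
Hypothesis t0B : t0 <= B.
Hypothesis zsw : forall q, sweeps_from b c t0 K (zq q).
Hypothesis ysw : sweeps_from b c t0 K y.
Hypothesis zy : forall e, 0 < e -> \forall q \near \oo, forall t, t0 <= t ->
  enorm (zq q t - y t) <= e.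

(** Freezing both curves before [t0] makes the difference Lipschitz and uniformly small on the whole
    line, as [weak_cvg] asks. *)
Let F q t := zq q (Num.max t t0) - y (Num.max t t0).

Let FK q : elip (K + K) (F q).
Proof.
have [zK _ _] := zsw q; have [yK _ _] := ysw.
have FK' := elipB zK yK.
move=> s t; apply: le_trans (FK' _ _) _.
rewrite ler_pM2l ?addr_gt0//; have N1 := ler_norm (s - t).
have N2 := ler_norm (t - s); rewrite distrC in N2.
by rewrite !maxEle; case: (leP s t0) => H1; case: (leP t t0) => H2;
  apply/ler_normlP; split; lra.
Qed.

Let K2 : 0 < K + K. Proof. exact: addr_gt0. Qed.

Let density q j := lip_density t0 B K2 (elip_coord j (FK q)).

Let g q j : R -> R := sval (cid (density q j)).

Let gP q j : [/\ measurable_fun setT (g q j), forall x, `|g q j x| <= K + K &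
  {ae lebesgue_measure, forall x, t0 < x < B ->
    is_derive x 1 (fun s => F q s ord0 j) (g q j x)}].
Proof. by rewrite /g; case: cid => /= h []. Qed.

(** A representative of the squared velocity difference that is measurable and bounded everywhere;
    [aeE] identifies it a.e. on []t0, B[]. *)
Let E q t := \sum_j g q j t ^+ 2.

Let mE q : measurable_fun setT (E q).
Proof.
by apply: measurable_sum => j; apply: measurable_funX; have [] := gP q j.
Qed.

Let M : R := n%:R * (K + K) ^+ 2.

Let M0 : 0 <= M. Proof. by rewrite mulr_ge0// sqr_ge0. Qed.

Let E0 q t : 0 <= E q t. Proof. by apply: sumr_ge0 => j _; exact: sqr_ge0. Qed.

Let EM q t : E q t <= M.
Proof.
rewrite /E /M mulr_natl -[X in _ *+ X](card_ord n) -sumr_const ler_sum// => j _.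
have [_ gK _] := gP q j.
by rewrite -[leLHS]real_normK ?num_real// lerXn2r// ?nnegrE ?(ltW K2).
Qed.

Let near_max t : t0 < t -> \forall s \near t, t0 < s.
Proof.
move=> t0t; have : t \in `]t0, +oo[ by rewrite in_itv/= t0t.
by move=> /near_in_itvoy; apply: filterS => s; rewrite in_itv/= andbT.
Qed.

Let aeE q (h : R -> 'rV[R]_n) :
  (forall t, t0 <= t -> h t = zq q t - y t) ->
  {ae lebesgue_measure, forall t, t0 < t < B -> enorm ('D_1 h t) ^+ 2 = E q t}.
Proof.
move=> hE.
have H : {ae lebesgue_measure, forall t, forall j, t0 < t < B ->
    is_derive t 1 (fun s => F q s ord0 j) (g q j t)}.
  by apply: lebesgue_ae_forall => j; have [] := gP q j.
apply: lebesgue_aeS H => t Ht tB.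
have dF : is_derive t 1 (F q) (\row_j g q j t).
  by apply: coord_is_derive => j; rewrite mxE; exact: Ht.
have Fh : \forall s \near t, F q s = h s.
  have /andP[t0t _] := tB; have := near_max t0t; apply: filterS => s /ltW t0s.
  by rewrite hE// /F max_l.
have [_ ->] := near_eq_is_derive Fh dF.
by rewrite enorm_sqr; apply: eq_bigr => j _; rewrite !mxE expr2.
Qed.

Let E_integrable q u v : lebesgue_measure.-integrable `[u, v] (EFin \o E q).
Proof.
apply: (bounded_itv_integrable (M := M)) => // t; rewrite ger0_norm//.
Qed.

(* Near a time [t1] where LPAF holds, every active set is contained in that of
   [y t1], so that [w] gives the squared speeds as linear functions of the
   velocities. *)
Let local_cvg t1 : LPAF b c t1 -> t0 <= t1 <= B -> exists2 d, 0 < d &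
  forall u v, t0 <= u -> v <= B -> t1 - d < u -> u <= v -> v < t1 + d ->
  \int[lebesgue_measure]_(x in `[u, v]) E q x @[q --> \oo] --> 0.
Proof.
move=> Lt1 /andP[t0t1 t1B].
have [yK Cy aey] := ysw.
have Cy1 := Cy _ t0t1; set J := active b c t1 (y t1).
pose w s := y t1 + facet_lift b J (fun i => c i s - c i t1).
have [r1 /= r10 Hr1] := (nbhs_ballP _ _).1 (lpaf_selection L0 cL Lt1 Cy1).
have [D D0 HD] := facet_lift_bound b.
have wK : elip (D * L) w.
  move=> s t; rewrite /w opprD addrACA subrr add0r facet_liftB -mulrA.
  apply: HD => [i _|]; last by rewrite mulr_ge0// ltW.
  by rewrite opprB addrA subrK; exact: cL.
have [rho rho0 Hrho] : exists2 rho : R, 0 < rho &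
    forall i, i \notin J -> rho < c i t1 - dotv (b i) (y t1).
  have : \forall r \near (0 : R), forall i, i \notin J -> r < c i t1 - dotv (b i) (y t1).
    apply: (@filter_forall R 'I_m (fun i r => i \notin J -> r < c i t1 - dotv (b i) (y t1))
      (nbhs (0 : R)) (nbhs_filter (0 : R))) => i.
    have [iJ|iJ] := boolP (i \in J); first exact: nearW.
    have gap : 0 < c i t1 - dotv (b i) (y t1).
      by rewrite subr_gt0 lt_neqAle Cy1 andbT; move: iJ; rewrite inE.
    apply/nbhs_ballP; exists (c i t1 - dotv (b i) (y t1)) => //= r.
    rewrite /ball/= sub0r normrN => Hr _; exact: le_lt_trans (ler_norm _) Hr.
  move=> /nbhs_ballP[r /= r0 Hr]; exists (r / 2); first by rewrite divr_gt0.
  apply: Hr; rewrite /ball/= sub0r normrN gtr0_norm ?divr_gt0//.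
  by rewrite gtr_pMr// invf_lt1// ltr1n.
pose beta := \sum_i enorm (b i) + 1.
have bbeta i : enorm (b i) <= beta.
  rewrite /beta (bigD1 i)//= -addrA lerDl addr_ge0//.
  by apply: sumr_ge0 => k _; exact: enorm_ge0.
have beta0 : 0 < beta.
  by rewrite ltr_wpDl// sumr_ge0// => k _; exact: enorm_ge0.
(* A constraint outside [J] has slack more than [rho] at [y t1]. Passing to time [s] and a point
   within [eta] of [y s] costs at most [beta * eta] plus [(beta * K + L) * d], each at most
   [rho / 4]. *)
pose eta := rho / 4 / beta.
have eta0 : 0 < eta by rewrite !divr_gt0.
have bKL : 0 < beta * K + L by rewrite addr_gt0// mulr_gt0.
pose d := Num.min r1 (rho / 4 / (beta * K + L)).
have d0 : 0 < d by rewrite lt_min r10 !divr_gt0.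
have dr1 : d <= r1 by rewrite ge_min lexx.
have drho : (beta * K + L) * d <= rho / 4.
  by rewrite mulrC -ler_pdivlMr// ge_min lexx orbT.
have etarho : beta * eta = rho / 4 by rewrite /eta mulrC divfK ?gt_eqF.
have activeJ s x i : `|s - t1| < d -> t0 <= s -> enorm (x - y s) <= eta ->
    i \in active b c s x -> i \in J.
  move=> sd t0s xy; apply: contraLR => iJ; rewrite inE.
  apply: negbT; apply/eqP => E1.
  have H1 := Hrho i iJ.
  have H2 : dotv (b i) (x - y t1) <= beta * (eta + K * `|s - t1|).
    apply: le_trans (ler_norm _) _; apply: le_trans (dotv_CS _ _) _.
    apply: ler_pM; rewrite ?enorm_ge0//.
    apply: le_trans (enorm_sub_add (y s) _ _) _; rewrite lerD//; exact: yK.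
  have H3 := cL i t1 s; rewrite [`|t1 - s|]distrC in H3.
  have H4 := le_trans (ler_norm _) H3.
  have H5 : (beta * K + L) * `|s - t1| <= rho / 4.
    by apply: le_trans drho; rewrite ler_pM2l// ltW.
  move: H2; rewrite dotvBr E1 => H2; move: H1 H2 H4 H5 etarho.
  rewrite mulrDr; lra.
exists d => // u v t0u vB tu uv vd.
pose Pv s := w s - y s - y s.
have PvK : elip (D * L + K + K) Pv by apply: elipB => //; exact: elipB.
have LP0 : 0 < D * L + K + K.
  by rewrite ltr_wpDl// addr_ge0 ?(ltW K0)// mulr_ge0// ltW.
have /boolp.choice[p Hp] : forall j, exists pj : R -> R, [/\ measurable_fun setT pj,
    forall x, `|pj x| <= D * L + K + K &
    {ae lebesgue_measure, forall x, t0 < x < B ->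
      is_derive x 1 (fun s => Pv s ord0 j) (pj x)}].
  by move=> j; have [pj [? ? ? _]] := lip_density t0 B LP0 (elip_coord j PvK); exists pj.
have tuv x : u < x < v -> t0 < x < B.
  by move=> /andP[ux xv]; rewrite (le_lt_trans t0u)//= (lt_le_trans xv).
have wc j : \int[lebesgue_measure]_(x in `[u, v]) (g q j x * p j x) @[q --> \oo] --> 0.
  have [mp pL aep] := Hp j.
  apply: (@weak_cvg _ (fun q s => F q s ord0 j) (fun q => g q j)
    (fun s => Pv s ord0 j) (p j) (K + K) (D * L + K + K)) => //.
  - by move=> q; exact: elip_coord.
  - move=> e e0; apply: filterS (zy e0) => q Hq x.
    apply: le_trans (coord_le_enorm _ _) _; apply: Hq.
    by rewrite le_max lexx orbT.
  - by move=> q; have [] := gP q j.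
  - by move=> q; have [] := gP q j.
  - by move=> q; have [_ _ H] := gP q j; apply: lebesgue_aeS H => x H /tuv.
  - exact: elip_coord.
  - by apply: lebesgue_aeS aep => x H /tuv.
have Esum : \forall q \near \oo, \sum_j \int[lebesgue_measure]_(x in `[u, v])
    (g q j x * p j x) = \int[lebesgue_measure]_(x in `[u, v]) E q x.
  apply: filterS (zy eta0) => q Hq.
  have mgp j : measurable_fun setT (fun x => g q j x * p j x).
    by have [? _ _] := gP q j; have [? _ _] := Hp j; exact: measurable_funM.
  rewrite -(@bounded_Rintegral_sum _ _ (fun j x => g q j x * p j x)
    ((K + K) * (D * L + K + K)))//; last first.
    move=> j x; have [_ gK _] := gP q j; have [_ pL _] := Hp j.
    by rewrite normrM ler_pM.
  apply: ae_eq_Rintegral => //; [|exact: measurable_funTS|].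
    by apply: measurable_funTS; exact: measurable_sum.
  have [zK Cz aez] := zsw q.
  have aeg : {ae lebesgue_measure, forall t, forall j, t0 < t < B ->
      is_derive t 1 (fun s => F q s ord0 j) (g q j t)}.
    by apply: lebesgue_ae_forall => j; have [] := gP q j.
  have aep : {ae lebesgue_measure, forall t, forall j, t0 < t < B ->
      is_derive t 1 (fun s => Pv s ord0 j) (p j t)}.
    by apply: lebesgue_ae_forall => j; have [] := Hp j.
  (* [D * L] may be zero, and a.e. differentiability is available for a positive constant. *)
  have wK' : elip (D * L + K) w.
    move=> s t; apply: le_trans (wK s t) _.
    by rewrite ler_wpM2r// lerDl ltW.
  have DLK : 0 < D * L + K by rewrite ltr_wpDl// mulr_ge0// ltW.
  apply: lebesgue_aeS (lebesgue_aeI (lebesgue_aeI aez aey) (lebesgue_aeI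
    (lebesgue_aeI aeg aep) (lebesgue_aeI (elip_ae_derivable DLK wK')
    (lebesgue_aeI (@lebesgue_ae_neq _ u) (@lebesgue_ae_neq _ v))))).
  move=> s [[Hz Hy] [[Hg Hps] [dw [su sv]]]]; rewrite /= in_itv/= => /andP[us sv'].
  have suv : u < s < v.
    by rewrite !lt_neqAle us sv' !andbT; apply/andP; split; apply/eqP; [move/esym|].
  have sB := tuv _ suv; have t0s : t0 < s by case/andP: sB.
  have sd : `|s - t1| < d by rewrite ltr_norml; lra.
  have {Hz}[dz Nz] := Hz t0s; have {Hy}[dy Ny] := Hy t0s.
  have {}Hg j := Hg j sB; have {}Hps j := Hps j sB.
  move: (is_derive_vderiv dz) Nz; move: ('D_1 (zq q) s) => pz {}dz Nz.
  move: (is_derive_vderiv dy) Ny; move: ('D_1 y s) => py {}dy Ny.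
  move: (is_derive_vderiv dw); move: ('D_1 w s) => pw {}dw.
  have dF : is_derive s 1 (F q) (pz - py).
    apply: near_eq_is_derive (is_deriveB dz dy); apply: filterS (near_max t0s) => r /ltW t0r.
    by rewrite /F max_l.
  have dP : is_derive s 1 Pv (pw - py - py) := is_deriveB (is_deriveB dw dy) dy.
  have gE j : g q j s = (pz - py) ord0 j.
    have [_ <-] := Hg j; have [_ ->] := is_derive_coord j dF; by [].
  have pE j : p j s = (pw - py - py) ord0 j.
    have [_ <-] := Hps j; have [_ ->] := is_derive_coord j dP; by [].
  (* Near [s], [c i] coincides with [dotv (b i) (w r)], so its derivative is read off from that of
     [w]. *)
  have dcJ i : i \in J -> is_derive s 1 (c i) (dotv (b i) pw).
    move=> iJ; apply: near_eq_is_derive (is_derive_dotvl (b i) dw).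
    have : s \in `]t1 - r1, t1 + r1[ by rewrite in_itv/=; move: sd; rewrite ltr_norml; lra.
    move=> /near_in_itvoo; apply: filterS => r; rewrite in_itv/= => rr1.
    by apply: (Hr1 r _).2 => //; rewrite /ball/= ltr_norml; lra.
  have vz : dotv pz pz = dotv pz pw.
    apply: (velocity_dot (near_above Cz t0s) dz Nz) => i iA; apply: dcJ.
    by apply: (activeJ s _ _ sd (ltW t0s) _ iA); exact: Hq (ltW t0s).
  have vy : dotv py py = dotv py pw.
    apply: (velocity_dot (near_above Cy t0s) dy Ny) => i iA; apply: dcJ.
    by apply: (activeJ s _ _ sd (ltW t0s) _ iA); rewrite subrr enorm0 ltW.
  have -> : \sum_i g q i s * p i s = dotv (pz - py) (pw - py - py).
    by apply: eq_bigr => j _; rewrite gE pE.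
  have -> : E q s = dotv (pz - py) (pz - py).
    by apply: eq_bigr => j _; rewrite gE expr2.
  rewrite !dotvBl !dotvBr (dotvC py pz); move: vz vy; lra.
apply: cvg_trans (near_eq_cvg Esum) _.
elim: (index_enum _) => [|j s IHs].
  by under eq_cvg do rewrite big_nil; exact: cvg_cst.
under eq_cvg do rewrite big_cons.
by have := cvgD (wc j) IHs; rewrite addr0; exact.
Qed.

(** Subtracting [M * \1_O] makes the integrand nonpositive on the open set [O] of exceptional times.
    The one-sided property of being eventually at most any [e > 0] then holds locally at every time
    and is additive over intervals; restoring the subtracted term costs at most [M] times the
    measure of [O]. *)
Let int_cvg : \int[lebesgue_measure]_(x in `[t0, B]) E q x @[q --> \oo] --> 0.
Proof.
apply/cvgrPdist_le => e e0.
have e2 : 0 < e / 2 by rewrite divr_gt0.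
have eM : 0 < e / 2 / (M + 1) by rewrite divr_gt0// ltr_wpDl.
have [ O [oO HO mO]] := ae_open_cover aeLPAF eM.
have mOR : measurable (O : set R) by exact: open_measurable.
have i0 x : 0 <= \1_O x :> R by rewrite indicE ler0n.
have i1 x : \1_O x <= 1 :> R by rewrite indicE -[leRHS]/(1%:R) ler_nat; case: (x \in O).
pose G q x := E q x - M * \1_O x.
have mG q : measurable_fun setT (G q).
  by apply: measurable_funB => //; apply: measurable_funM.
have GM q x : `|G q x| <= M + M.
  rewrite /G (le_trans (ler_normB _ _))// lerD//; first by rewrite ger0_norm.
  by rewrite normrM !ger0_norm// ler_piMr.
have Gint q u v : lebesgue_measure.-integrable `[u, v] (EFin \o G q).
  exact: bounded_itv_integrable (mG q) (GM q).
have P : forall e, 0 < e -> \forall q \near \oo,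
    \int[lebesgue_measure]_(x in `[t0, B]) G q x <= e.
  pose P u v := forall e, 0 < e -> \forall q \near \oo,
    \int[lebesgue_measure]_(x in `[u, v]) G q x <= e.
  apply: (@interval_induction _ P) => //.
    move=> u v w _ uv vw _ Puv Pvw r r0.
    have r2 : 0 < r / 2 by rewrite divr_gt0.
    apply: filterS2 (Puv _ r2) (Pvw _ r2) => q H1 H2.
    have -> : \int[lebesgue_measure]_(x in `[u, w]) G q x =
        \int[lebesgue_measure]_(x in `[u, v]) G q x +
        \int[lebesgue_measure]_(x in `[v, w]) G q x.
      exact: bounded_Rintegral_itvD (mG q) (GM q).
    by rewrite [r]splitr lerD.
  move=> t tB; have [Lt|/HO Ot] := pselect (LPAF b c t).
    have [d d0 Hd] := local_cvg Lt tB; exists d => // u v t0u vB tu ut tv vd r r0.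
    have uv : u <= v by exact: le_trans tv.
    have /cvgrPdist_le/(_ _ r0) := Hd u v t0u vB tu uv vd.
    apply: filterS => q; rewrite sub0r normrN => /(le_trans (ler_norm _)).
    apply: le_trans; apply: le_Rintegral => // x _.
    by rewrite /G gerBl mulr_ge0.
  have /nbhs_ballP[d /= d0 dO] := open_nbhs_nbhs (conj oO Ot).
  exists d => // u v t0u vB tu ut tv vd r r0; apply: nearW => q.
  have uv : u <= v by exact: le_trans tv.
  apply: (@le_trans _ _ (\int[lebesgue_measure]_(x in `[u, v]) (cst 0 x))).
    apply: le_Rintegral => //.
      by apply: (bounded_itv_integrable (M := 0)) => // x; rewrite normr0.
    move=> x; rewrite /= in_itv/= => /andP[ux xv].
    have Ox : O x by apply: dO; rewrite /ball/= ltr_norml; lra.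
    by rewrite /G indicE mem_set// mulr1 subr_le0.
  by rewrite Rintegral_cst// mul0r ltW.
have OM : M * \int[lebesgue_measure]_(x in `[t0, B]) \1_O x <= e / 2.
  have IO : \int[lebesgue_measure]_(x in `[t0, B]) \1_O x <= e / 2 / (M + 1).
    have Hle : (lebesgue_measure (O `&` `[t0, B]) <= (e / 2 / (M + 1))%:E)%E.
      apply: le_trans (ltW mO); apply: le_measure; rewrite ?inE//.
      exact: measurableI.
    have Hfin : lebesgue_measure (O `&` `[t0, B]) \is a fin_num.
      by rewrite ge0_fin_numE ?measure_ge0//; exact: le_lt_trans Hle (ltry _).
    rewrite /Rintegral (integral_indic lebesgue_measure (measurable_itv _) mOR).
    by rewrite -lee_fin fineK.
  have := ler_wpM2l M0 IO; have M1 : 0 < M + 1 by rewrite ltr_wpDl.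
  move/le_trans; apply; rewrite mulrCA ler_piMr ?(ltW e2)//.
  by rewrite ler_pdivrMr// mul1r lerDl.
apply: filterS (P _ e2) => q Hq; rewrite sub0r normrN ger0_norm; last exact: Rintegral_ge0.
have Oint : lebesgue_measure.-integrable `[t0, B] (EFin \o (\1_O : R -> R)).
  by apply: (bounded_itv_integrable (M := 1)) => // x; rewrite ger0_norm.
have : \int[lebesgue_measure]_(x in `[t0, B]) G q x =
  \int[lebesgue_measure]_(x in `[t0, B]) E q x - M * \int[lebesgue_measure]_(x in `[t0, B]) \1_O x.
  rewrite /G RintegralB//; last first.
    apply: (bounded_itv_integrable (M := M)); first exact: measurable_funM.
    by move=> x; rewrite normrM !ger0_norm// ler_piMr.
  by rewrite RintegralZl.
move: Hq OM; lra.
Qed.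

(** The curve [h] is arbitrary before [t0], because the original solution is too; the threshold on
    [q] is uniform in [h]. *)
Lemma strong_convergence e : 0 < e -> \forall q \near \oo, forall h : R -> 'rV[R]_n,
  (forall t, t0 <= t -> h t = zq q t - y t) ->
  (\int[lebesgue_measure]_(t in `[t0, B])
     (enorm (h t) ^+ 2 + enorm ('D_1 h t) ^+ 2)%:E <= e%:E)%E.
Proof.
move=> e0; have e2 : 0 < e / 2 by rewrite divr_gt0.
pose D := B - t0 + 1; have D0 : 0 < D by rewrite /D ltr_wpDl// subr_ge0.
(* As [k <= 1], [k ^+ 2 <= k], so the positions contribute at most [e / 2] over an interval of
   length less than [D]. *)
pose k := Num.min 1 (e / 2 / D).
have k0 : 0 < k by rewrite lt_min ltr01 !divr_gt0.
have kk : k ^+ 2 <= e / 2 / D.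
  rewrite expr2; apply: (@le_trans _ _ k); last by rewrite ge_min lexx orbT.
  by rewrite ler_piMr ?(ltW k0)// ge_min lexx.
move/cvgrPdist_le : int_cvg => /(_ _ e2).
apply: filterS2 (zy k0) => q Hq HE h hE.
have {}HE : \int[lebesgue_measure]_(x in `[t0, B]) E q x <= e / 2.
  by move: HE; rewrite sub0r normrN => /(le_trans (ler_norm _)).
pose G x := k ^+ 2 + E q x.
have mG : measurable_fun setT G by apply: measurable_funD.
have GM x : `|G x| <= k ^+ 2 + M.
  by rewrite ger0_norm ?addr_ge0 ?sqr_ge0// lerD.
have Gi : lebesgue_measure.-integrable `[t0, B] (EFin \o G).
  exact: bounded_itv_integrable mG GM.
apply: (@le_trans _ _ (\int[lebesgue_measure]_(t in `[t0, B]) (G t)%:E)%E).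
  (* Measurability of ['D_1 h] is not established; the comparison is with the measurable [G]. *)
  apply: ae_le_integral_nonmeasurable => //.
  - by apply/measurable_EFinP; exact: measurable_funTS mG.
  - by move=> x _; rewrite lee_fin addr_ge0 ?sqr_ge0.
  - by move=> x _; rewrite lee_fin addr_ge0 ?sqr_ge0.
  apply: lebesgue_aeS (lebesgue_aeI (aeE hE)
    (lebesgue_aeI (@lebesgue_ae_neq _ t0) (@lebesgue_ae_neq _ B))).
  move=> t [Ht [tt0 tB]]; rewrite /= in_itv/= => /andP[t0t tB'].
  have tI : t0 < t < B.
    by rewrite !lt_neqAle t0t tB' !andbT; apply/andP; split; apply/eqP; [move/esym|].
  rewrite lee_fin Ht// /G lerD2r lerXn2r ?nnegrE ?enorm_ge0 ?(ltW k0)// hE//.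
  exact: Hq.
have -> : (\int[lebesgue_measure]_(t in `[t0, B]) (G t)%:E)%E =
    (\int[lebesgue_measure]_(t in `[t0, B]) G t)%:E.
  by rewrite /Rintegral fineK//; apply: integrable_fin_num Gi.
rewrite lee_fin /G RintegralD//; last first.
  apply: (bounded_itv_integrable (M := k ^+ 2)) => // x.
  by rewrite ger0_norm// sqr_ge0.
rewrite Rintegral_cst// fine_lebesgue_itv// [leRHS]splitr lerD//.
apply: (@le_trans _ _ (e / 2 / D * (B - t0))).
  by rewrite ler_wpM2r// subr_ge0.
by rewrite -mulrA ler_piMr ?(ltW e2)// mulrC ler_pdivrMr// mul1r /D lerDl.
Qed.

End strong_convergence.

(** * Uniform constants, the Sobolev norm and the conclusion *)

Lemma uniform_lipschitz (R : realType) (I : finType) (c : I -> R -> R) :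
  (forall i, lipschitz (c i)) ->
  exists2 L : R, 0 < L & forall i s t, `|c i s - c i t| <= L * `|s - t|.
Proof.
move=> cL.
have H : \forall M \near +oo, forall i, M.-lipschitz (c i).
  apply: (@filter_forall R I (fun i M => M.-lipschitz (c i)) (pinfty_nbhs R) _) => i.
  exact: cL.
have [L [L0 HL]] : exists L : R, 0 < L /\ forall i, L.-lipschitz (c i).
  near (pinfty_nbhs R) => L; exists L; split; first by near: L; exact: nbhs_pinfty_gt.
  by near: L.
by exists L => // i s t; apply: (HL i (s, t)).
Unshelve. all: by end_near. Qed.

Lemma abs_continuous_eq (R : realType) (n : nat) (a b : R) (f g : R -> 'rV[R]_n) :
  (forall t, a <= t -> f t = g t) -> abs_continuous a b f -> abs_continuous a b g.
Proof.
move=> fg acf e e0; have [d d0 Hd] := acf e e0; exists d => // N x y xy tri xyd.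
rewrite (eq_bigr (fun k => enorm (f (y k) - f (x k)))); first exact: Hd.
by move=> k _; have [/andP[axk xyk] _] := xy k; rewrite !fg// (le_trans axk).
Qed.

Lemma W12_norm_le (R : realType) (n : nat) (a b e : R) (f : R -> 'rV[R]_n) :
  0 <= e -> abs_continuous a b f ->
  (\int[lebesgue_measure]_(t in `[a, b])
     (enorm (f t) ^+ 2 + enorm ('D_1 f t) ^+ 2)%:E <= (e ^+ 2)%:E)%E ->
  (0 <= W12_norm a b f <= e%:E)%E.
Proof.
move=> e0 acf fe; rewrite /W12_norm asboolT// poweR_ge0/=.
have -> : e%:E = ((e ^+ 2)%:E `^ 2^-1)%E.
  by rewrite poweR_EFin powR12_sqrt ?sqr_ge0// sqrtr_sqr ger0_norm.
apply: gt0_ler_poweR => //; rewrite ?in_itv/= ?leey ?andbT ?lee_fin ?sqr_ge0//.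
by apply: integral_ge0 => t _; rewrite lee_fin addr_ge0// sqr_ge0.
Qed.

Theorem theorem3 (R : realType) (n m : nat) (T t0 : R)
    (b : 'I_m -> 'rV[R]_n) (c : 'I_m -> R -> R) (z : R -> 'rV[R]_n) :
  0 < T ->
  (forall i, lipschitz (c i)) ->
  (forall i, periodic (c i) T) ->
  (forall t, polyhedron b c t !=set0) ->
  (forall t, compact (polyhedron b c t)) ->
  {ae lebesgue_measure, forall t : R, LPAF b c t} ->
  sweeping_solution (polyhedron b c) `[t0, +oo[ z ->
  exists zbar : R -> 'rV[R]_n,
    [/\ sweeping_solution (polyhedron b c) `]-oo, +oo[ zbar,
        periodic zbar T
      & W12_norm t0 (t0 + T) (fun t => z (t + T *+ q) - zbar t)
          @[q --> \oo] --> 0%E].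
Proof.
move=> T0 clip cT Cne Cc aeL zsol.
have [L L0 cL] := uniform_lipschitz clip.
have [K K0 Zsw] := solution_sweeps_from L0 cL zsol.
set Z := (fun t => z (Num.max t t0)) in Zsw.
have [y [ysw yT Zy]] := periodic_limit L0 cL T0 cT Cc aeL K0 Zsw.
have [zbar [zbsol zbT zbK zbE]] := periodic_extension T0 cT K0 ysw yT.
exists zbar; split=> //.
have Tn0 q : 0 <= T *+ q by rewrite mulrn_wge0// ltW.
have ZE q t : t0 <= t -> Z (t + T *+ q) = z (t + T *+ q).
  by move=> t0t; rewrite /Z max_l// ler_wpDr.
have Zqsw q : sweeps_from b c t0 K (fun t => Z (t + T *+ q)).
  apply: (@sweeps_fromW _ _ _ _ _ (t0 - T *+ q)); first by rewrite lerBlDr lerDl.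
  exact: sweeps_shift.
have t0T : t0 <= t0 + T by rewrite lerDl ltW.
pose h q t := z (t + T *+ q) - zbar t.
have hE q t : t0 <= t -> h q t = Z (t + T *+ q) - y t.
  by move=> t0t; rewrite /h ZE// zbE.
have hac q : abs_continuous t0 (t0 + T) (h q).
  apply: (@abs_continuous_eq _ _ _ _ (fun t => Z (t + T *+ q) - zbar t)).
    by move=> t t0t; rewrite ZE.
  apply: (@elip_abs_continuous _ _ (K + K)); first by rewrite addr_ge0// ltW.
  by apply: elipB => //; have [] := Zqsw q.
have W e : 0 < e -> \forall q \near \oo, (0 <= W12_norm t0 (t0 + T) (h q) <= e%:E)%E.
  move=> e0; have e2 : 0 < e ^+ 2 by rewrite exprn_gt0.
  apply: filterS (strong_convergence L0 cL aeL K0 t0T Zqsw ysw Zy e2) => q Hq.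
  by apply: W12_norm_le => //; [exact: ltW | exact: Hq (hE q)].
apply/fine_cvgP; split.
  apply: filterS (W _ ltr01) => q /andP[W0 W1].
  by rewrite ge0_fin_numE//; exact: le_lt_trans W1 (ltry _).
apply/cvgrPdist_le => e e0; apply: filterS (W _ e0) => q /andP[W0 W1].
have Wfin : W12_norm t0 (t0 + T) (h q) \is a fin_num.
  by rewrite ge0_fin_numE//; exact: le_lt_trans W1 (ltry _).
rewrite sub0r normrN /= ger0_norm; last exact: fine_ge0.
by rewrite -lee_fin fineK.
Qed.
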